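(* Let $\mathcal M,\mathcal N$ be von Neumann algebras, $\mathcal N$ acting on a Hilbert space $\mathcal H$, let $f\in\mathrm{OC}(0,+\infty)$ and $\Phi,\Psi\in\mathrm{CP}(\mathcal M,\mathcal N)$. Let $\Gamma\in\mathrm{CP}(\mathcal M,\mathcal N)$ satisfy $\Phi\le_{\mathrm{cp}}c_\Phi\Gamma$ and $\Psi\le_{\mathrm{cp}}c_\Psi\Gamma$ for some $c_\Phi,c_\Psi>0$. Let $(\pi,V,\mathcal K)$ be a minimal Stinespring representation of $\Gamma$, and let $A',B'\in\pi(\mathcal M)'_+$ be the corresponding Radon--Nikodym derivatives, i.e. $\Phi(x)=V^*A'\pi(x)V$ and $\Psi(x)=V^*B'\pi(x)V$ for all $x\in\mathcal M$. Then $$\widehat S_f(\Phi\|\Psi)=V^*\phi_f(A',B')V .$$ In particular, the right-hand side is independent of the choice of the dominating completely positive map $\Gamma$.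
   Context: Conventions. $\mathrm{CP}(\mathcal M,\mathcal N)$ is the set of all completely positive linear maps $\mathcal M\to\mathcal N$ (not assumed normal); $\Phi\le_{\mathrm{cp}}\Gamma$ means that $\Gamma-\Phi$ is completely positive. $\mathcal N_*^+$ is the positive cone of the predual. Inner products are linear in the first variable. $\mathrm{OC}(0,+\infty)$ is the set of real-valued operator convex functions on $(0,+\infty)$. We put $0\cdot(+\infty)=0$. Extended lower-semibounded part. For a von Neumann algebra $\mathcal N$, $\widehat{\mathcal N}_{\mathrm{lb}}$ is the set of maps $m:\mathcal N_*^+\to(-\infty,+\infty]$ that are positively homogeneous ($m(\lambda\varphi)=\lambda m(\varphi)$, $\lambda\ge0$), additive, norm lower semicontinuous, and satisfy $m(\varphi)\ge\ell\varphi(1)$ for some $\ell\in\mathbb R$ and all $\varphi$. Order and operations are pointwise; $a\in\mathcal N_{\mathrm{sa}}$ is identified with $\varphi\mapsto\varphi(a)$. For $C\in\mathbb B(\mathcal H,\mathcal K)$ and $m\in\widehat{\mathbb B(\mathcal K)}_{\mathrm{lb}}$, $C^*mC\in\widehat{\mathbb B(\mathcal H)}_{\mathrm{lb}}$ is $(C^*mC)(\omega)=m(C\omega C^* )$ with $(C\omega C^* )(X)=\omega(C^*XC)$. If $\mathcal N$ acts on $\mathcal H$, then $m\in\widehat{\mathcal N}_{\mathrm{lb}}$ is identified with $\omega\mapsto m(\omega|_{\mathcal N})$ in $\widehat{\mathbb B(\mathcal H)}_{\mathrm{lb}}$; this identifies $\widehat{\mathcal N}_{\mathrm{lb}}$ with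 the elements $m$ of $\widehat{\mathbb B(\mathcal H)}_{\mathrm{lb}}$ affiliated with $\mathcal N$ (i.e. $u'^*mu'=m$ for all unitaries $u'\in\mathcal N'$). Perspective and Pusz--Woronowicz functional calculus. For $f\in\mathrm{OC}(0,+\infty)$ let $f(+0)=\lim_{t\downarrow0}f(t)$, $f'(+\infty)=\lim_{t\to+\infty}f(t)/t$, and define $\phi_f:[0,\infty)^2\to(-\infty,+\infty]$ by $\phi_f(s,t)=tf(s/t)$ for $s,t>0$, $\phi_f(s,0)=f'(+\infty)s$, $\phi_f(0,t)=f(+0)t$. If $R,S\in\mathbb B(\mathcal L)_+$ with $R+S=I$ and $R=\int_{[0,1]}t\,dE(t)$, then $\phi_f(R,S)\in\widehat{\mathbb B(\mathcal L)}_{\mathrm{lb}}$ is $\phi_f(R,S)(\omega)=\int_{[0,1]}\phi_f(t,1-t)\,d\omega(E(t))$. For general $A,B\in\mathbb B(\mathcal K)_+$ let $\mathcal L=\overline{\operatorname{ran}}(A+B)$, $T:\mathcal K\to\mathcal L$, $T\zeta=(A+B)^{1/2}\zeta$, let $R,S\in\mathbb B(\mathcal L)_+$ be the unique operators with $A=T^*RT$, $B=T^*ST$, $R+S=I_{\mathcal L}$, and put $\phi_f(A,B)=T^*\phi_f(R,S)T$. Divergence. A minimal Stinespring representation $(\pi,V,\mathcal K)$ of $\Gamma\in\mathrm{CP}(\mathcal M,\mathcal N)$ consists of a unital $*$-representation $\pi$ of $\mathcal M$ on $\mathcal K$ and $V\in\mathbb B(\mathcal H,\mathcal K)$ with $\Gamma(x)=V^*\pi(x)V$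 and $\overline{\operatorname{span}}\,\pi(\mathcal M)V\mathcal H=\mathcal K$. For $\Phi,\Psi\in\mathrm{CP}(\mathcal M,\mathcal N)$, let $(\pi,V,\mathcal K)$ be a minimal Stinespring representation of $\Phi+\Psi$ and $A',B'\in\pi(\mathcal M)'$ the unique positive contractions with $\Phi(x)=V^*A'\pi(x)V$, $\Psi(x)=V^*B'\pi(x)V$ (so $A'+B'=I$); $(\pi,V,\mathcal K;A',B')$ is called a minimal SRN realization of $(\Phi,\Psi)$. The maximal $f$-divergence is $\widehat S_f(\Phi\|\Psi)=V^*\phi_f(A',B')V$ (computed from the minimal SRN realization), which is an element of $\widehat{\mathcal N}_{\mathrm{lb}}\subseteq\widehat{\mathbb B(\mathcal H)}_{\mathrm{lb}}$, independent of the choice of minimal SRN realization. *)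

(* Defs.v *)
From HB Require Import structures.
From mathcomp Require Import all_boot all_order all_algebra.
From mathcomp Require Import all_classical all_reals all_analysis.
From mathcomp Require Import complex.

Set Implicit Arguments.
Unset Strict Implicit.
Unset Printing Implicit Defensive.

Import Order.TTheory GRing.Theory Num.Theory.
Import numFieldNormedType.Exports.

Local Open Scope classical_set_scope.
Local Open Scope ring_scope.
Local Open Scope complex_scope.
Local Open Scope sesquilinear_scope.

(* The form [inner] is linear in its first argument and conjugate linear in
   its second one. *)
HB.mixin Record isHilbert (R : realType) (H : Type)
    of CompleteNormedModule R[i] H := {
  inner : {dot H for Num.conj};
  innerE : forall x : H, `|x| ^+ 2 = inner x x }.

#[short(type="hilbertType")]
HB.structure Definition Hilbert (R : realType) :=
  {H of CompleteNormedModule R[i] H & isHilbert R H}.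

Section BoundedOperators.
Context {R : realType}.
Variables H K : hilbertType R.

Definition bounded_linear (f : H -> K) : Prop :=
  linear f /\ exists c, forall x, `|f x| <= c * `|x|.

Definition bop_pred : {pred H -> K} := fun f => `[< bounded_linear f >].

Record bop := Bop { bop_val :> H -> K; bop_valP : bop_val \in bop_pred }.

HB.instance Definition _ := [isSub for bop_val].
HB.instance Definition _ := [Choice of bop by <:].

Lemma bop_submod_closed : submod_closed bop_pred.
Proof.
split=> [|a f g].
  apply/asboolP; split=> [b x y /=|]; first by rewrite scaler0 addr0.
  by exists 0 => x; rewrite normr0 mul0r.
move=> /asboolP[lf [c cf]] /asboolP[lg [d dg]]; apply/asboolP; split.
  move=> b x y; rewrite -[_ (b *: x + y)]/(a *: f (b *: x + y) + g (b *: x + y)).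
  by rewrite lf lg !scalerDr !scalerA [a * b]mulrC addrACA.
exists (`|a| * c + d) => x; rewrite mulrDl -mulrA.
rewrite (le_trans (ler_normD _ _))// lerD//.
by rewrite -[X in `|X|]/(a *: f x) normrZ ler_wpM2l.
Qed.

HB.instance Definition _ :=
  GRing.isSubmodClosed.Build _ _ bop_pred bop_submod_closed.
HB.instance Definition _ := [SubChoice_isSubLmodule of bop by <:].

End BoundedOperators.

Arguments bop_pred {R} H K _.

Notation "''B' ( H , K )" := (bop H K)
  (at level 8, format "''B' ( H ,  K )") : type_scope.
Notation "''B' ( H )" := (bop H H)
  (at level 8, format "''B' ( H )") : type_scope.

Section OperatorAlgebra.
Context {R : realType}.
Implicit Types H K L : hilbertType R.

Lemma bop_id_subproof H : (id : H -> H) \in bop_pred H H.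
Proof. by apply/asboolP; split=> //; exists 1 => x; rewrite mul1r. Qed.

Definition bop_id H : 'B(H) := Bop (bop_id_subproof H).

Lemma bop_comp_subproof H K L (A : 'B(K, L)) (B : 'B(H, K)) :
  (A \o B : H -> L) \in bop_pred H L.
Proof.
case: A B => [A /= /asboolP[lA [a hA]]] [B /= /asboolP[lB [b hB]]].
apply/asboolP; split=> [c x y /=|]; first by rewrite lB lA.
exists (`|a| * b) => x /=; rewrite -mulrA (le_trans (hA _))//.
have [->|Bx0] := eqVneq (B x) 0.
  by rewrite normr0 mulr0 mulr_ge0// (le_trans _ (hB x)).
have a0 : 0 <= a.
  by rewrite -(@pmulr_lge0 _ `|B x|) ?normr_gt0// (le_trans _ (hA _)).
by rewrite ger0_norm// ler_wpM2l.
Qed.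

Definition bop_comp H K L (A : 'B(K, L)) (B : 'B(H, K)) : 'B(H, L) :=
  Bop (bop_comp_subproof A B).

(* [adjoint A] is well defined by the Riesz representation theorem; [sqrtop A] is
   the positive square root, and only makes sense for a positive operator. *)
Definition adjoint H K (A : 'B(H, K)) : 'B(K, H) :=
  xget 0 [set B : 'B(K, H) | forall x y, inner (A x) y = inner x (B y)].

Definition posop H (A : 'B(H)) : Prop := forall x, 0 <= inner (A x) x.

Definition contraction H (A : 'B(H)) : Prop := forall x, `|A x| <= `|x|.

Definition sqrtop H (A : 'B(H)) : 'B(H) :=
  xget 0 [set B : 'B(H) | posop B /\ bop_comp B B = A].

Definition projection H (P : 'B(H)) : Prop :=
  bop_comp P P = P /\ adjoint P = P.

End OperatorAlgebra.

Notation "1%:B" := (bop_id _) (at level 1, format "1%:B") : ring_scope.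
Notation "A *o B" := (bop_comp A B)
  (at level 40, left associativity, format "A  *o  B") : ring_scope.
Notation "A ^*o" := (adjoint A) (at level 2, format "A ^*o") : ring_scope.

Section ClosedSubspaces.
Context {R : realType}.
Variable K : hilbertType R.

Record closed_subspace := ClosedSubspace {
  csub_set :> set K;
  csub0 : csub_set 0;
  csubP : forall (a : R[i]) x y, csub_set x -> csub_set y -> csub_set (a *: x + y);
  csub_closed : closed csub_set }.

Variable L : closed_subspace.

Definition csub_pred : {pred K} := mem (csub_set L).

Record csub := Csub { csub_val :> K; csub_valP : csub_val \in csub_pred }.

HB.instance Definition _ := [isSub for csub_val].
HB.instance Definition _ := [Choice of csub by <:].

Lemma csub_submod_closed : submod_closed csub_pred.
Proof.
split=> [|a x y]; first by rewrite inE; exact: csub0.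
by rewrite !inE => Lx Ly; exact: csubP.
Qed.

HB.instance Definition _ :=
  GRing.isSubmodClosed.Build _ _ csub_pred csub_submod_closed.
HB.instance Definition _ := [SubChoice_isSubLmodule of csub by <:].

Let csub_norm (x : csub) : R[i] := `|csub_val x|.

Let csub_normD x y : csub_norm (x + y) <= csub_norm x + csub_norm y.
Proof. exact: ler_normD. Qed.

Let csub_normZ (a : R[i]) x : csub_norm (a *: x) = `|a| * csub_norm x.
Proof. exact: normrZ. Qed.

Let csub_norm0 x : csub_norm x = 0 -> x = 0.
Proof. by move=> /normr0_eq0 x0; exact: val_inj. Qed.

HB.instance Definition _ :=
  Lmodule_isNormed.Build R[i] csub csub_normD csub_normZ csub_norm0.

Lemma csub_complete (F : set_system csub) :
  ProperFilter F -> cauchy F -> cvg F.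
Proof.
move=> FF Fc.
have /cauchy_cvgP/cvg_ex[/= l Fl] : cauchy (csub_val @ F).
  apply/cauchyP => e e0; move/cauchyP : Fc => /(_ e e0)[x Fx].
  exists (csub_val x) => /=; apply: filterS Fx => y /=.
  by rewrite -!ball_normE.
have Ll : l \in csub_pred.
  rewrite inE; apply: (closed_cvg _ (@csub_closed L) _ l Fl).
  by apply: nearW => x; have := csub_valP x; rewrite inE.
apply/cvg_ex; exists (Csub Ll); apply/(@cvgrPdist_lt _ csub) => e e0.
move/cvgrPdist_lt : Fl => /(_ e e0). exact.
Qed.

HB.instance Definition _ := Uniform_isComplete.Build csub csub_complete.

Definition csub_inner (x y : csub) : R[i] := inner (csub_val x) (csub_val y).

Let csub_inner_linearl u : GRing.linear_for *%R (csub_inner ^~ u).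
Proof. by move=> a x y; rewrite /csub_inner linearPl. Qed.

Let csub_inner_linearr u :
  GRing.linear_for (Num.conj \; *%R) (csub_inner u).
Proof. by move=> a x y; rewrite /csub_inner linearPr. Qed.

HB.instance Definition _ := @bilinear_isBilinear.Build R[i] csub csub R[i]
  *%R (Num.conj \; *%R) csub_inner (conj csub_inner_linearl csub_inner_linearr).

Let csub_inner_herm x y :
  csub_inner x y = (-1) ^+ false * Num.conj (csub_inner y x).
Proof. by rewrite /csub_inner; exact: hermitian_subproof. Qed.

HB.instance Definition _ :=
  isHermitianSesquilinear.Build R[i] csub false Num.conj csub_inner csub_inner_herm.

Let csub_inner_gt0 u : u != 0 -> 0 < csub_inner u u.
Proof. by move=> u0; rewrite /csub_inner; exact: neq0_dnorm_gt0. Qed.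

HB.instance Definition _ :=
  isDotProduct.Build R[i] csub csub_inner csub_inner_gt0.

Let csub_innerE (x : csub) : `|x| ^+ 2 = csub_inner x x.
Proof. exact: innerE. Qed.

HB.instance Definition _ := isHilbert.Build R csub csub_innerE.

End ClosedSubspaces.

Section ClosedRange.
Context {R : realType}.
Variables (H K : hilbertType R) (A : 'B(H, K)).

Let cran := closure (range A).

Let A_linear : linear A. Proof. by have /asboolP[] := bop_valP A. Qed.

Let cran0 : cran 0.
Proof.
apply: subset_closure; exists 0 => //=.
by have := A_linear (-1) 0 0; rewrite scaler0 addr0 scaleN1r addNr.
Qed.

Let cranP (a : R[i]) x y : cran x -> cran y -> cran (a *: x + y).
Proof.
rewrite {1 2}/cran closureEcvg => -[F FF [Fx AF]] [G GG [Gy AG]].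
have FGxy : (a *: u.1 + u.2) @[u --> filter_prod F G] --> a *: x + y.
  apply: cvgD; first by apply: cvgZl_tmp; apply: cvg_trans Fx; exact: cvg_fst.
  by apply: cvg_trans Gy; exact: cvg_snd.
apply: (closed_cvg _ (@closed_closure _ (range A)) _ _ FGxy).
have : filter_prod F G (range A `*` range A).
  by exists (range A, range A) => //; split; [apply: AF|apply: AG].
apply: filterS => -[_ _] [[/= u _ <-] [v _ <-]]; apply: subset_closure.
by exists (a *: u + v) => //; rewrite A_linear.
Qed.

Definition closed_range : closed_subspace K :=
  ClosedSubspace cran0 cranP (@closed_closure _ (range A)).

End ClosedRange.

Section VonNeumannAlgebras.
Context {R : realType}.
Implicit Types H K : hilbertType R.

Definition commutant H (S : set 'B(H)) : set 'B(H) :=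
  [set y | forall x, S x -> x *o y = y *o x].

Definition von_neumann H (M : set 'B(H)) : Prop :=
  [/\ M 1%:B,
      forall (a : R[i]) x y, M x -> M y -> M (a *: x + y),
      forall x y, M x -> M y -> M (x *o y),
      forall x, M x -> M x^*o
    & commutant (commutant M) = M].

Definition posmx H n (X : 'M['B(H)]_n) : Prop :=
  forall xi : 'I_n -> H, 0 <= \sum_i \sum_j inner (X i j (xi j)) (xi i).

(* A map defined on the algebra [M] is encoded by a function on the whole of
   'B(H0), whose values outside of [M] are never used. *)
Definition CP H0 H (M : set 'B(H0)) (N : set 'B(H)) :
    set ('B(H0) -> 'B(H)) :=
  [set Phi | [/\
      forall x, M x -> N (Phi x),
      forall (a : R[i]) x y, M x -> M y -> Phi (a *: x + y) = a *: Phi x + Phi y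
    & forall n (X : 'M['B(H0)]_n), (forall i j, M (X i j)) ->
        posmx X -> posmx (map_mx Phi X)]].

Definition cp_le H0 H (M : set 'B(H0)) (N : set 'B(H))
    (Phi Gamma : 'B(H0) -> 'B(H)) : Prop :=
  CP M N (fun x => Gamma x - Phi x).

Definition unital_star_rep H0 K (M : set 'B(H0)) (pi : 'B(H0) -> 'B(K)) : Prop :=
  [/\ pi 1%:B = 1%:B,
      forall (a : R[i]) x y, M x -> M y -> pi (a *: x + y) = a *: pi x + pi y,
      forall x y, M x -> M y -> pi (x *o y) = pi x *o pi y
    & forall x, M x -> pi x^*o = (pi x)^*o].

Definition linear_span K (S : set K) : set K :=
  [set z | exists n (a : 'I_n -> R[i]) (s : 'I_n -> K),
    (forall i, S (s i)) /\ z = \sum_i a i *: s i].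

Definition minimal_stinespring H0 H K (M : set 'B(H0))
    (Gamma : 'B(H0) -> 'B(H)) (pi : 'B(H0) -> 'B(K)) (V : 'B(H, K)) : Prop :=
  [/\ unital_star_rep M pi,
      forall x, M x -> Gamma x = V^*o *o pi x *o V
    & closure (linear_span [set pi x (V h) | x in M & h in [set: H]]) = setT].

Definition RN_derivative H0 H K (M : set 'B(H0)) (Phi : 'B(H0) -> 'B(H))
    (pi : 'B(H0) -> 'B(K)) (V : 'B(H, K)) (A : 'B(K)) : Prop :=
  [/\ commutant (pi @` M) A, posop A
    & forall x, M x -> Phi x = V^*o *o A *o pi x *o V].

Definition minimal_SRN H0 H K (M : set 'B(H0)) (Phi Psi : 'B(H0) -> 'B(H))
    (pi : 'B(H0) -> 'B(K)) (V : 'B(H, K)) (A B : 'B(K)) : Prop :=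
  [/\ minimal_stinespring M (fun x => Phi x + Psi x) pi V,
      RN_derivative M Phi pi V A, contraction A,
      RN_derivative M Psi pi V B & contraction B].

Definition dominated_realization H0 H K (M : set 'B(H0)) (N : set 'B(H))
    (Phi Psi Gamma : 'B(H0) -> 'B(H)) (pi : 'B(H0) -> 'B(K)) (V : 'B(H, K))
    (A B : 'B(K)) : Prop :=
  [/\ CP M N Gamma,
      exists c : R, 0 < c /\ cp_le M N Phi (fun x => c%:C *: Gamma x),
      exists c : R, 0 < c /\ cp_le M N Psi (fun x => c%:C *: Gamma x),
      minimal_stinespring M Gamma pi V
    & RN_derivative M Phi pi V A /\ RN_derivative M Psi pi V B].

End VonNeumannAlgebras.

Section OperatorConvexity.
Context {R : realType}.

Definition psdmx n (A : 'M[R[i]]_n) : Prop :=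
  A \is hermsymmx /\ forall v : 'rV_n, 0 <= (v *m A *m v ^t Num.conj) 0 0.

Definition posdefmx n (A : 'M[R[i]]_n) : Prop :=
  A \is hermsymmx /\ forall a, eigenvalue A a -> 0 < a.

Definition funmx (f : R -> R) n (A : 'M[R[i]]_n) : 'M[R[i]]_n :=
  invmx (spectralmx A)
    *m diag_mx (map_mx (fun z => (f (complex.Re z))%:C) (spectral_diag A))
    *m spectralmx A.

(* Operator convexity on the open half-line; the values of [f] outside of it
   are irrelevant. *)
Definition operator_convex (f : R -> R) : Prop :=
  forall n (A B : 'M[R[i]]_n) (l : R),
    posdefmx A -> posdefmx B -> 0 <= l <= 1 ->
    psdmx (l%:C *: funmx f A + (1 - l)%:C *: funmx f B
           - funmx f (l%:C *: A + (1 - l)%:C *: B)).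

End OperatorConvexity.

Section PuszWoronowicz.
Context {R : realType}.
Implicit Types H K L : hilbertType R.

(* Positive cone of the predual of 'B(H): sigma-weakly continuous functionals
   that are positive. *)
Definition predual_pos H : set ('B(H) -> R[i]) :=
  [set omega |
    (exists xi eta : nat -> H,
      [/\ cvgn (series (fun n => `|xi n| ^+ 2 : R[i]^o)),
          cvgn (series (fun n => `|eta n| ^+ 2 : R[i]^o))
        & forall X : 'B(H), series (fun n => inner (X (xi n)) (eta n) : R[i]^o) @ \oo
                      --> (omega X : R[i]^o)])
    /\ forall X, posop X -> 0 <= omega X].

(* An element m of the extended lower-semibounded part of 'B(H) is represented by
   a function on all functionals, of which only the values on [predual_pos H]
   are meaningful; [compress C m] is the map C^* m C : omega |-> m (C omega C^* ), where
   (C omega C^* )(X) = omega (C^* X C). *)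
Definition compress H K (C : 'B(H, K)) (m : ('B(K) -> R[i]) -> \bar R) :
    ('B(H) -> R[i]) -> \bar R :=
  fun omega => m (fun X => omega (C^*o *o X *o C)).

Definition value0 (f : R -> R) : \bar R := lim ((f u)%:E @[u --> (0 : R)^'+]).

Definition slope_infty (f : R -> R) : \bar R := lim ((f u / u)%:E @[u --> +oo]).

(* Only used for s, t >= 0. *)
Definition perspective (f : R -> R) (s t : R) : \bar R :=
  if t == 0 then (slope_infty f * s%:E)%E
  else if s == 0 then (value0 f * t%:E)%E
  else (t * f (s / t))%:E.

(* Projection-valued Borel measures on the line carried by the unit interval. *)
Definition is_spectral_measure L (E : set R -> 'B(L)) : Prop :=
  [/\ forall D, measurable D -> projection (E D),
      E [set` `[(0 : R), 1]] = 1%:B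
    & forall F : (set R)^nat, (forall n, measurable (F n)) ->
        trivIset setT F ->
        forall x, series (fun n => E (F n) x) @ \oo --> E (\bigcup_n F n) x].

(* The spectral measure of a positive contraction, determined on Borel sets by
   A = \int_[0,1] t dE(t), this being understood weakly. *)
Definition spectral_measure L (A : 'B(L)) : set R -> 'B(L) :=
  xget (fun=> 0) [set E | is_spectral_measure E /\
    forall x,
      (\int[fun D => (complex.Re (inner (E D x) x))%:E]_(t in `[0%R, 1%R]) t%:E
       = (complex.Re (inner (A x) x))%:E)%E].

(* The map attached to (A, 1 - A), for a positive contraction [A]. *)
Definition pw_calculus1 (f : R -> R) L (A : 'B(L)) :
    ('B(L) -> R[i]) -> \bar R :=
  fun omega =>
    (\int[fun D => (complex.Re (omega (spectral_measure A D)))%:E]_(t in `[0%R, 1%R])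
       perspective f t (1 - t)%R)%E.

(* A is T^* R T and B is T^* S T, with T the corestriction of (A + B)^(1/2) to the
   closure L of the range of A + B, and R + S = 1 on L. *)
Definition pw_calculus (f : R -> R) K (A B : 'B(K)) :
    ('B(K) -> R[i]) -> \bar R :=
  let L := csub (closed_range (A + B)) in
  let T := xget 0 [set T : 'B(K, L) |
    forall z, csub_val (T z) = sqrtop (A + B) z] in
  let RS := xget (0, 0) [set RS : 'B(L) * 'B(L) |
    [/\ posop RS.1, posop RS.2, A = T^*o *o RS.1 *o T,
        B = T^*o *o RS.2 *o T & RS.1 + RS.2 = 1%:B]] in
  compress T (pw_calculus1 f RS.1).

(* The value on [predual_pos] does not depend on the realization chosen by
   [xget], and the set of realizations is never empty when Phi and Psi are
   completely positive. *)
Definition max_fdiv H0 H (M : set 'B(H0)) (f : R -> R)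
    (Phi Psi : 'B(H0) -> 'B(H)) : ('B(H) -> R[i]) -> \bar R :=
  xget (fun=> 0%E) [set m | exists (K : hilbertType R)
    (pi : 'B(H0) -> 'B(K)) (V : 'B(H, K)) (A B : 'B(K)),
    minimal_SRN M Phi Psi pi V A B /\ m = compress V (pw_calculus f A B)].

End PuszWoronowicz.

(* Main.v *)
Require Import Defs.
From HB Require Import structures.
From mathcomp Require Import all_boot all_order all_algebra.
From mathcomp Require Import all_classical all_reals all_analysis.
From mathcomp Require Import measurable_realfun.
From mathcomp Require Import complex ring lra.

(** The functional calculus of a pair [(A, B)] is, by definition, the calculus of
    a pair [(X, Y)] with [X + Y = 1] living on the closed range [L] of [A + B],
    pulled back along [T], the corestriction to [L] of the square root of
    [A + B].  When [A] and [B] commute with [pi], the space [L] is invariant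
    under [pi], and [T] intertwines [pi] with its restriction [piL] to [L].
    Therefore [(piL, T V, L; X, Y)] is a minimal realization of [(Phi, Psi)]:
    the identity [(T V)^* piL(x) (T V) = V^* (A + B) pi(x) V] shows that it
    represents [Phi + Psi], and [T] has dense range.  By construction it gives
    the same value as [(pi, V, K; A, B)].  This is [realization_to_SRN], and it
    applies to the representation of a dominating map as well as to the one
    chosen in the definition of the divergence.

    It remains to compare two minimal realizations of the pair.  They are
    related by a unitary that carries one derivative to the other
    ([stinespring_unitary]), so the calculus of a positive operator has to be
    invariant under unitaries ([pw_calculus1_transport]).  As the spectral
    measure is an arbitrarily chosen representing family, this rests on the
    uniqueness of that family, [represents_uniq].  If [E] and [F] both represent
    [A] and [a < b], then [A^n] grows at most like [a^n] on the range of
    [E `]-oo, a]] and at least like [b^n] on that of [F `[b, +oo[], and all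
    these projections commute with [A]; so the two ranges are orthogonal.  Hence
    [E] and [F] agree on half-lines, and then on all Borel sets.

    The Hilbert space theory that this needs is developed first: the Riesz
    representation ([riesz]), which gives adjoints and orthogonal projections,
    and the existence, uniqueness and commutation properties of positive square
    roots. *)

Set Implicit Arguments.
Unset Strict Implicit.
Unset Printing Implicit Defensive.

Import Order.TTheory GRing.Theory Num.Theory.
Import numFieldNormedType.Exports.
Import HBNNSimple.

Local Open Scope classical_set_scope.
Local Open Scope ring_scope.
Local Open Scope complex_scope.

(** * The real inner product *)

Section RealInner.
Context {R : realType}.
Variable H : hilbertType R.
Implicit Types x y z : H.

(** Inner products and norms take values in [R[i]].  Working with their real
    parts keeps every estimate in the ordered field [R], and loses nothing:
    the imaginary part of [inner x y] is [rdot x ('i *: y)]. *)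
Definition rdot x y : R := complex.Re (inner x y).
Definition nrm x : R := complex.Re `|x|.

Lemma ReD (a b : R[i]) : complex.Re (a + b) = complex.Re a + complex.Re b.
Proof. by case: a b => a1 a2 [b1 b2]. Qed.
Lemma ReN (a : R[i]) : complex.Re (- a) = - complex.Re a.
Proof. by case: a => a1 a2. Qed.
Lemma ReCM (r : R) (a : R[i]) : complex.Re (r%:C * a) = r * complex.Re a.
Proof. by case: a => a1 a2 /=; rewrite mul0r subr0. Qed.

Lemma nrmE x : `|x| = (nrm x)%:C.
Proof. by rewrite /nrm RRe_real ?normr_real. Qed.

Lemma nrm_ge0 x : 0 <= nrm x.
Proof. by rewrite -ler0c -nrmE. Qed.

Lemma nrm_eq0 x : nrm x = 0 -> x = 0.
Proof. by move=> x0; apply/eqP; rewrite -normr_eq0 nrmE x0. Qed.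

Lemma nrm0 : nrm 0 = 0.
Proof. by rewrite /nrm normr0. Qed.

Lemma nrmD x y : nrm (x + y) <= nrm x + nrm y.
Proof. by rewrite -lecR rmorphD/= -!nrmE ler_normD. Qed.

Lemma nrmN x : nrm (- x) = nrm x.
Proof. by rewrite /nrm normrN. Qed.

Lemma nrmB x y : nrm (x - y) = nrm (y - x).
Proof. by rewrite -nrmN opprB. Qed.

Lemma nrm_dist x y z : nrm (x - z) <= nrm (x - y) + nrm (y - z).
Proof. by rewrite (le_trans _ (nrmD _ _))// addrA subrK. Qed.

Lemma nrmZ (a : R[i]) x : nrm (a *: x) = complex.Re `|a| * nrm x.
Proof. by rewrite {1}/nrm normrZ nrmE mulrC ReCM mulrC. Qed.

Lemma nrmZr (r : R) x : nrm (r%:C *: x) = `|r| * nrm x.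
Proof. by rewrite nrmZ normc_def/= expr0n/= addr0 sqrtr_sqr. Qed.

Lemma nrm_sqr x : nrm x ^+ 2 = rdot x x.
Proof. by rewrite /rdot -innerE nrmE -rmorphXn. Qed.

Lemma rdotDl x y z : rdot (x + y) z = rdot x z + rdot y z.
Proof. by rewrite /rdot linearDl ReD. Qed.
Lemma rdotNl x z : rdot (- x) z = - rdot x z.
Proof. by rewrite /rdot linearNl ReN. Qed.
Lemma rdotBl x y z : rdot (x - y) z = rdot x z - rdot y z.
Proof. by rewrite rdotDl rdotNl. Qed.
Lemma rdotZl (r : R) x z : rdot (r%:C *: x) z = r * rdot x z.
Proof. by rewrite /rdot linearZl_LR/= ReCM. Qed.
Lemma inner_conj x y : inner x y = (inner y x)^*.
Proof. by rewrite (hermC inner)/= expr0 mul1r. Qed.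
Lemma rdotC x y : rdot x y = rdot y x.
Proof. by rewrite /rdot inner_conj; case: (inner y x). Qed.
Lemma rdotDr x y z : rdot z (x + y) = rdot z x + rdot z y.
Proof. by rewrite rdotC rdotDl !(rdotC z). Qed.
Lemma rdotNr x z : rdot z (- x) = - rdot z x.
Proof. by rewrite rdotC rdotNl !(rdotC z). Qed.
Lemma rdotBr x y z : rdot z (x - y) = rdot z x - rdot z y.
Proof. by rewrite rdotDr rdotNr. Qed.
Lemma rdotZr (r : R) x z : rdot z (r%:C *: x) = r * rdot z x.
Proof. by rewrite rdotC rdotZl !(rdotC z). Qed.
Lemma rdot0l z : rdot 0 z = 0.
Proof. by rewrite /rdot linear0l. Qed.
Lemma rdot0r z : rdot z 0 = 0.
Proof. by rewrite rdotC rdot0l. Qed.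
Lemma Im_inner x y : complex.Im (inner x y) = rdot x ('i *: y).
Proof.
rewrite /rdot linearZr_LR/=; case: (inner x y) => a b /=.
by rewrite mul0r mulN1r opprK add0r.
Qed.
Lemma rdot_ext x y : (forall z, rdot x z = rdot y z) -> x = y.
Proof.
move=> xy; apply/eqP; rewrite -subr_eq0; apply/eqP/nrm_eq0/eqP.
by rewrite -sqrf_eq0 nrm_sqr rdotBl xy subrr.
Qed.

(** The discriminant argument behind the Cauchy-Schwarz inequalities, for the
    inner product and for the semidefinite form of a positive operator. *)
Lemma quad_discr (a b c : R) : 0 <= c ->
  (forall t, 0 <= a + 2 * b * t + c * t ^+ 2) -> b ^+ 2 <= a * c.
Proof.
rewrite le_eqVlt => /predU1P[<- h|c0 h].
  rewrite mulr0; have [->|b0] := eqVneq b 0; first by rewrite expr0n.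
  have := h (- (a + 1) / (2 * b)); rewrite mul0r addr0 mulrC divfK ?mulf_neq0//.
  by lra.
have := h (- b / c).
have -> : a + 2 * b * (- b / c) + c * (- b / c) ^+ 2 = (a * c - b ^+ 2) / c.
  by field; rewrite gt_eqF.
by rewrite pmulr_lge0 ?invr_gt0// subr_ge0.
Qed.

Lemma rdot_CS x y : rdot x y ^+ 2 <= (nrm x * nrm y) ^+ 2.
Proof.
rewrite exprMn !nrm_sqr; apply: quad_discr; first by rewrite -nrm_sqr sqr_ge0.
move=> t; have := sqr_ge0 (nrm (x + t%:C *: y)).
rewrite nrm_sqr rdotDl !rdotDr !rdotZl !rdotZr [rdot y x]rdotC.
by rewrite (_ : _ + _ = rdot x x + 2 * rdot x y * t + rdot y y * t ^+ 2)//; ring.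
Qed.

Lemma rdot_le x y : rdot x y <= nrm x * nrm y.
Proof.
apply: (le_trans (ler_norm _)).
rewrite -(@ler_pXn2r _ 2)// ?nnegrE// ?mulr_ge0 ?nrm_ge0//.
by rewrite real_normK ?num_real// rdot_CS.
Qed.

Lemma parallelogram x y :
  nrm (x - y) ^+ 2 = 2 * nrm x ^+ 2 + 2 * nrm y ^+ 2 - nrm (x + y) ^+ 2.
Proof. by rewrite !nrm_sqr !(rdotBl, rdotBr, rdotDl, rdotDr) (rdotC y x); ring. Qed.
End RealInner.

Lemma inner_rdot (R : realType) (H K : hilbertType R) (x y : H) (x' y' : K) :
  rdot x y = rdot x' y' -> rdot x ('i *: y) = rdot x' ('i *: y') ->
  inner x y = inner x' y'.
Proof.
move=> h1 h2; apply/eqP; rewrite eq_complex; apply/andP; split; apply/eqP => //.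
by rewrite !Im_inner.
Qed.

(** * Convergent sequences and Riesz representation *)

Section Convergence.
Context {R : realType}.
Variable H : hilbertType R.
Implicit Types (x y z l : H) (u v : nat -> H).

(** Norm convergence with real tolerances; this is [u @ \oo --> l], by
    [cvg_ncvg] and [ncvg_cvg], whose tolerances live in [R[i]]. *)
Definition ncvg u l : Prop :=
  forall e : R, 0 < e -> exists N, forall n, (N <= n)%N -> nrm (u n - l) < e.

Lemma gt0_complex (e : R[i]) : 0 < e -> exists2 r : R, 0 < r & e = r%:C.
Proof.
by case: e => a b; rewrite ltcE/= => /andP[/eqP-> a0]; exists a.
Qed.

Lemma cvg_ncvg u l : u @ \oo --> l -> ncvg u l.
Proof.
move=> /cvgrPdist_lt h e e0.
have /h[N _ hN] : (0 : R[i]) < e%:C by rewrite ltcR.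
by exists N => n /hN /=; rewrite nrmE ltcR nrmB.
Qed.

Lemma ncvg_cvg u l : ncvg u l -> u @ \oo --> l.
Proof.
move=> ul; apply/cvgrPdist_lt => _ /gt0_complex[e e0 ->].
by have [N hN] := ul _ e0; exists N => // n /hN; rewrite nrmE ltcR nrmB.
Qed.

Lemma ncvg_cauchy u :
  (forall e : R, 0 < e -> exists N, forall m n, (N <= m)%N -> (N <= n)%N ->
     nrm (u m - u n) < e) ->
  exists l, ncvg u l.
Proof.
move=> h; suff /cvg_ex[l /cvg_ncvg ul] : cvgn u by exists l.
apply/cauchy_cvgP/cauchy_exP => _ /gt0_complex[e e0 ->].
have [N hN] := h _ e0; exists (u N); exists N => // n /= Nn.
by rewrite -ball_normE/= nrmE ltcR hN.
Qed.

Lemma closure_nrm (S : set H) x :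
  closure S x <-> forall e : R, 0 < e -> exists2 y, S y & nrm (x - y) < e.
Proof.
split=> [h e e0|h B /nbhs_ballP[_ /gt0_complex[e e0 ->] eB]].
  have /h[y [Sy]] : nbhs x (ball x e%:C) by apply: nbhsx_ballx; rewrite ltcR.
  by rewrite -ball_normE/= nrmE ltcR => ?; exists y.
have [y Sy xy] := h _ e0; exists y; split=> //; apply: eB.
by rewrite -ball_normE/= nrmE ltcR.
Qed.

Lemma le_eps (a b : R) : (forall e, 0 < e -> a <= b + e) -> a <= b.
Proof. by move=> h; apply/ler_addgt0Pr => e e0; apply: h. Qed.

Lemma nrm_eps0 x : (forall e : R, 0 < e -> nrm x <= e) -> x = 0.
Proof.
move=> h; apply/nrm_eq0/le_anti; rewrite nrm_ge0 andbT; apply: le_eps => e e0.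
by rewrite add0r h.
Qed.

Lemma ncvg_uniq u l l' : ncvg u l -> ncvg u l' -> l = l'.
Proof.
move=> ul ul'; apply/eqP; rewrite -subr_eq0; apply/eqP/nrm_eps0 => e e0.
have e2 : 0 < e / 2 by lra.
have [N hN] := ul _ e2; have [N' hN'] := ul' _ e2.
have := hN _ (leq_maxl N N'); have := hN' _ (leq_maxr N N').
set n := maxn _ _ => h1 h2.
by rewrite (le_trans (nrm_dist l (u n) l'))// (nrmB l); lra.
Qed.

(** Minimising [|y|^2 - 2 phi y]: minimising sequences are Cauchy by the
    parallelogram law, and stationarity at the minimiser is the claim. *)
Lemma riesz (phi : H -> R) (c : R) : 0 <= c ->
  (forall x y, phi (x + y) = phi x + phi y) ->
  (forall (r : R) x, phi (r%:C *: x) = r * phi x) ->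
  (forall x, phi x <= c * nrm x) ->
  exists y, forall x, phi x = rdot x y.
Proof.
move=> c0 phiD phiZ phic.
have phi0 : phi 0 = 0 by have := phiD 0 0; rewrite addr0; lra.
have phiN x : phi (- x) = - phi x by have := phiD x (- x); rewrite subrr phi0; lra.
pose J x := nrm x ^+ 2 - 2 * phi x.
have Jlb x : - c ^+ 2 <= J x.
  have := phic x; have := sqr_ge0 (nrm x - c); rewrite /J => h1 h2; nra.
pose d := inf (range J).
have hinf : has_inf (range J).
  by split; [exists (J 0), 0|exists (- c ^+ 2) => _ [x _ <-]].
have dJ x : d <= J x by apply: ge_inf; [exact: hinf.2|exists x].
have Jmid x y : nrm (x - y) ^+ 2 <= 2 * J x + 2 * J y - 4 * d.
  have := dJ (2^-1%:C *: (x + y)).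
  rewrite parallelogram /J nrmZr exprMn phiZ phiD ger0_norm ?invr_ge0// => h.
  by lra.
have exJ n : exists x, J x < d + n.+1%:R^-1.
    have n0 : 0 < (n.+1%:R^-1 : R) by rewrite invr_gt0.
    by have [_ [x _ <-]] := inf_adherent n0 hinf; exists x.
have [u uJ] := boolp.choice exJ.
have [y uy] : exists y, ncvg u y.
  apply: ncvg_cauchy => e e0.
  have e2 : 0 < e ^+ 2 / 4 by rewrite divr_gt0// exprn_gt0.
  have [N _ /(_ N (leqnn _)) hN] := near_infty_natSinv_lt (PosNum e2).
  exists N => m n Nm Nn; rewrite -(@ltr_pXn2r _ 2)// ?nnegrE ?nrm_ge0 ?ltW//.
  rewrite (le_lt_trans (Jmid _ _))//.
  have inv_le k : (N <= k)%N -> (k.+1%:R^-1 : R) < e ^+ 2 / 4.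
    by move=> Nk; rewrite (le_lt_trans _ hN)// lef_pV2 ?posrE// ler_nat.
  have := uJ m; have := uJ n; have := inv_le _ Nm; have := inv_le _ Nn.
  by move: (m.+1%:R^-1) (n.+1%:R^-1) (e ^+ 2) (J _) (J _) => a1 a2 a3 a4 a5; lra.
have Jy x : J y <= J x.
  rewrite (le_trans _ (dJ x))//.
  (* Once [|w - y| <= 1], this bounds [J y - J w] by a multiple of [|w - y|]. *)
  have Jcont w : J y <= J w + nrm (w - y) * (nrm (w - y) + 2 * nrm y + 2 * c).
    have h1 : nrm y <= nrm (w - y) + nrm w by rewrite nrmB -{1}(subrK w y) nrmD.
    have h2 : nrm w <= nrm (w - y) + nrm y by rewrite -{1}(subrK y w) nrmD.
    have h3 : phi w - phi y <= c * nrm (w - y).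
      by rewrite (le_trans _ (phic _))// phiD phiN.
    have := nrm_ge0 y; have := nrm_ge0 w; have := nrm_ge0 (w - y); rewrite /J; nra.
  apply: le_eps => e e0.
  have e2 : 0 < e / 2 by lra.
  pose C := 1 + 2 * nrm y + 2 * c.
  have C0 : 0 < C by have := nrm_ge0 y; rewrite /C; lra.
  have dlt0 : 0 < Num.min 1 (e / 2 / C) by rewrite lt_min ltr01 divr_gt0.
  have [N1 hN1] := uy _ dlt0.
  have [N2 _ /(_ N2 (leqnn _)) hN2] := near_infty_natSinv_lt (PosNum e2).
  have := hN1 _ (leq_maxl N1 N2); set n := maxn _ _.
  rewrite lt_min ltr_pdivlMr// => /andP[D1 D2].
  have nN2 : (n.+1%:R^-1 : R) < e / 2.
    by rewrite (le_lt_trans _ hN2)// lef_pV2 ?posrE// ler_nat ltnS leq_maxr.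
  rewrite (le_trans (Jcont (u n)))//.
  have : nrm (u n - y) * (nrm (u n - y) + 2 * nrm y + 2 * c) <= e / 2.
    rewrite (le_trans _ (ltW D2))// ler_wpM2l ?nrm_ge0// /C; lra.
  have := uJ n; move: nN2; move: (nrm (u n - y) * _) (J (u n)) (n.+1%:R^-1) => q z b; lra.
exists y => x.
have : (phi x - rdot x y) ^+ 2 <= 0 * nrm x ^+ 2.
  apply: quad_discr; first by rewrite sqr_ge0.
  move=> t; have := Jy (y - t%:C *: x).
  rewrite /J !nrm_sqr !(rdotBl, rdotBr) !(rdotZl, rdotZr) (rdotC y x).
  rewrite phiD phiN phiZ => h.
  by lra.
rewrite mul0r => h; apply/eqP; rewrite -subr_eq0 -sqrf_eq0.
by apply/eqP/le_anti; rewrite h sqr_ge0.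
Qed.

End Convergence.

(** * Adjoints and positive operators *)

Section BoundedOps.
Context {R : realType}.
Implicit Types H K L : hilbertType R.

Section Linearity.
Variables (H K : hilbertType R) (A : 'B(H, K)).

Lemma bopP (a : R[i]) x y : A (a *: x + y) = a *: A x + A y.
Proof. by have /asboolP[lA _] := bop_valP A; exact: lA. Qed.
Lemma bop0 : A 0 = 0.
Proof. by have := bopP (-1) 0 0; rewrite scaler0 addr0 scaleN1r addNr. Qed.
Lemma bopD x y : A (x + y) = A x + A y.
Proof. by have := bopP 1 x y; rewrite !scale1r. Qed.
Lemma bopZ a x : A (a *: x) = a *: A x.
Proof. by have := bopP a x 0; rewrite bop0 !addr0. Qed.
Lemma bopN x : A (- x) = - A x.
Proof. by rewrite -scaleN1r bopZ scaleN1r. Qed.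
Lemma bopB x y : A (x - y) = A x - A y.
Proof. by rewrite bopD bopN. Qed.

Lemma bop_bound : exists2 c : R, 0 < c & forall x, nrm (A x) <= c * nrm x.
Proof.
have /asboolP[_ [a hA]] := bop_valP A.
exists (`|complex.Re a| + 1) => [|x]; first by rewrite ltr_wpDl.
have := hA x; rewrite !nrmE lecE => /andP[_]; rewrite mulrC ReCM /= => h.
have := nrm_ge0 x; have := ler_norm (complex.Re a); nra.
Qed.
End Linearity.

Lemma bop_ext H K (A B : 'B(H, K)) : (forall x, A x = B x) -> A = B.
Proof. by move=> AB; apply/val_inj/funext. Qed.

Lemma bop_eqE H K (A B : 'B(H, K)) : A = B -> forall x, A x = B x.
Proof. by move=> ->. Qed.

Lemma bopDE H K (A B : 'B(H, K)) x : (A + B) x = A x + B x.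
Proof. by []. Qed.
Lemma bopBE H K (A B : 'B(H, K)) x : (A - B) x = A x - B x.
Proof. by []. Qed.
Lemma bopZE H K (a : R[i]) (A : 'B(H, K)) x : (a *: A) x = a *: A x.
Proof. by []. Qed.
Lemma bop0E H K x : (0 : 'B(H, K)) x = 0.
Proof. by []. Qed.

Lemma bop_of_bound H K (f : H -> K) (c : R) : linear f ->
  (forall x, nrm (f x) <= c * nrm x) -> exists A : 'B(H, K), forall x, A x = f x.
Proof.
move=> lf fc; have bf : f \in bop_pred H K.
  apply/asboolP; split=> //; exists c%:C => x.
  by rewrite !nrmE -rmorphM lecR.
by exists (Bop bf).
Qed.

Lemma bop_compA H K L (M : hilbertType R) (A : 'B(L, M)) (B : 'B(K, L)) (C : 'B(H, K)) :
  A *o (B *o C) = A *o B *o C.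
Proof. exact: bop_ext. Qed.

Lemma rdotZ H (a : R[i]) (x y : H) : rdot (a *: x) y = rdot x (a^* *: y).
Proof.
rewrite /rdot linearZl_LR linearZr_LR; congr (complex.Re (_ * _)).
by rewrite conjCK.
Qed.

Lemma rdotZr_conj H (a : R[i]) (x y : H) : rdot x (a *: y) = rdot (a^* *: x) y.
Proof. by rewrite rdotZ conjCK. Qed.

(** The point is that an adjoint exists at all: by [riesz] applied to
    [fun x => rdot (A x) y] for each [y]. *)
Lemma adjoint_inner H K (A : 'B(H, K)) x y : inner (A x) y = inner x (A^*o y).
Proof.
rewrite /adjoint; case: xgetP => [B -> /= ->//|noadj].
have [c c0 Ac] := bop_bound A.
have /boolp.choice[B hB] : forall y, exists z, forall x, rdot (A x) y = rdot x z.
  move=> z; apply: (@riesz _ _ (fun x => rdot (A x) z) (c * nrm z)).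
  - by rewrite mulr_ge0 ?nrm_ge0 ?ltW.
  - by move=> u v; rewrite bopD rdotDl.
  - by move=> r u; rewrite bopZ rdotZl.
  - move=> u; rewrite (le_trans (rdot_le _ _))// mulrAC.
    by rewrite ler_wpM2r ?nrm_ge0.
exfalso.
have [||B' B'E] := @bop_of_bound K H B c.
- move=> a u v; apply: rdot_ext => w.
  by rewrite rdotC [RHS]rdotC -hB !rdotDr !rdotZr_conj -!hB bopZ.
- move=> u; have [->|B0] := eqVneq (nrm (B u)) 0.
    by rewrite mulr_ge0 ?nrm_ge0 ?ltW.
  rewrite -(@ler_pM2l _ (nrm (B u))) ?lt_def ?B0 ?nrm_ge0// -expr2 nrm_sqr -hB.
  rewrite (le_trans (rdot_le _ _))// mulrA ler_wpM2r ?nrm_ge0//.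
  by rewrite (le_trans (Ac _))// mulrC.
apply: (noadj B') => /= u v.
apply: inner_rdot; rewrite B'E -?hB //.
by rewrite rdotZr_conj -bopZ hB -rdotZr_conj.
Qed.

Lemma adjoint_rdot H K (A : 'B(H, K)) x y : rdot (A x) y = rdot x (A^*o y).
Proof. by rewrite /rdot adjoint_inner. Qed.

Lemma adjoint_rdotr H K (A : 'B(H, K)) x y : rdot (A^*o x) y = rdot x (A y).
Proof. by rewrite rdotC -adjoint_rdot rdotC. Qed.

Lemma adjoint_uniq H K (A : 'B(H, K)) (B : 'B(K, H)) :
  (forall x y, rdot (A x) y = rdot x (B y)) -> A^*o = B.
Proof.
move=> AB; apply: bop_ext => x; apply: rdot_ext => y.
by rewrite adjoint_rdotr rdotC AB rdotC.
Qed.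

Lemma adjointK H K (A : 'B(H, K)) : A^*o^*o = A.
Proof. by apply: adjoint_uniq => x y; rewrite adjoint_rdotr. Qed.

Lemma adjoint_comp H K L (A : 'B(K, L)) (B : 'B(H, K)) :
  (A *o B)^*o = B^*o *o A^*o.
Proof. by apply: adjoint_uniq => x y /=; rewrite !adjoint_rdot. Qed.

Lemma posop_rdot H (A : 'B(H)) x : posop A -> 0 <= rdot (A x) x.
Proof. by move=> /(_ x); rewrite lecE/= => /andP[]. Qed.

Lemma conj_i : Num.conj ('i : R[i]) = - 'i.
Proof. by apply/eqP; rewrite eq_complex/= oppr0 !eqxx. Qed.

(** Polarisation: the imaginary part of [<A(x + iy), x + iy>] vanishes. *)
Lemma posop_sym H (A : 'B(H)) x y : posop A -> rdot (A x) y = rdot x (A y).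
Proof.
move=> pA.
have im0 (z : H) : rdot (A z) ('i *: z) = 0.
  by rewrite -Im_inner; have := pA z; rewrite lecE/= => /andP[/eqP].
have ii : 'i * 'i = -1 :> R[i] by rewrite -expr2 sqr_i.
have rdot_i (u v : H) : rdot ('i *: u) ('i *: v) = rdot u v.
  by rewrite rdotZ scalerA conj_i mulNr ii opprK scale1r.
have := im0 (x + 'i *: y); rewrite bopD scalerDr rdotDl !rdotDr !im0 add0r addr0.
rewrite scalerA ii scaleN1r rdotNr bopZ rdot_i (rdotC (A y)).
by move: (rdot _ _) (rdot _ _) => p q; lra.
Qed.

Lemma posop_intro H (A : 'B(H)) :
  (forall x y, rdot (A x) y = rdot x (A y)) -> (forall x, 0 <= rdot (A x) x) ->
  posop A.
Proof.
move=> sA pA x; rewrite lecE; apply/andP; split; last exact: pA.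
rewrite Im_inner/=; apply/eqP.
have : rdot (A x) ('i *: x) = - rdot (A x) ('i *: x); last by lra.
by rewrite [LHS]sA bopZ rdotC rdotZ conj_i scaleNr rdotNr.
Qed.

Lemma posop_gram H K (A : 'B(H, K)) : posop (A^*o *o A).
Proof.
apply: posop_intro => [x y|x] /=; first by rewrite adjoint_rdotr -adjoint_rdot.
by rewrite adjoint_rdotr -nrm_sqr sqr_ge0.
Qed.

Lemma posop_CS H (A : 'B(H)) x y : posop A ->
  rdot (A x) y ^+ 2 <= rdot (A x) x * rdot (A y) y.
Proof.
move=> pA; apply: quad_discr; first exact: posop_rdot.
move=> t; have := posop_rdot (x + t%:C *: y) pA.
rewrite bopD bopZ rdotDl !rdotDr !rdotZl !rdotZr (posop_sym y x pA) (rdotC y).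
move: (rdot (A x) x) (rdot (A x) y) (rdot (A y) y) => p q r.
by rewrite (_ : _ + _ = p + 2 * q * t + r * t ^+ 2)//; ring.
Qed.

(** Cauchy-Schwarz for the form of [A] at [x] and [A x].  The upper bound on the
    form is only asked at the vector [A x], so the lemma also serves when [A]
    is bounded by [c] on an invariant subspace alone. *)
Lemma posop_nrm H (A : 'B(H)) x (c : R) : posop A ->
  rdot (A (A x)) (A x) <= c * nrm (A x) ^+ 2 ->
  nrm (A x) ^+ 2 <= c * rdot (A x) x.
Proof.
move=> pA h; have [->|A0] := eqVneq (A x) 0.
  by rewrite nrm0 expr0n/= rdot0l mulr0.
have n0 : 0 < nrm (A x) ^+ 2.
  rewrite exprn_gt0// lt_def nrm_ge0 andbT; apply: contra A0 => /eqP/nrm_eq0->.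
  exact: eqxx.
rewrite -(ler_pM2r n0) -expr2 {1}nrm_sqr (le_trans (posop_CS _ _ pA))//.
by rewrite mulrAC [leLHS]mulrC ler_wpM2r// posop_rdot.
Qed.

Lemma posop_le_nrm H (A : 'B(H)) (c : R) : 0 <= c -> posop A ->
  (forall x, rdot (A x) x <= c * nrm x ^+ 2) -> forall x, nrm (A x) <= c * nrm x.
Proof.
move=> c0 pA h x; rewrite -(@ler_pXn2r _ 2) ?nnegrE ?mulr_ge0 ?nrm_ge0//.
rewrite (le_trans (posop_nrm pA (h _)))// exprMn expr2 -mulrA ler_wpM2l//.
Qed.

Lemma posop_contraction H (X Y : 'B(H)) : posop X -> posop Y ->
  X + Y = 1%:B -> Defs.contraction X.
Proof.
move=> pX pY XY x; rewrite !nrmE lecR -[leRHS]mul1r.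
apply: posop_le_nrm => // z; rewrite mul1r nrm_sqr.
have Yz : Y z = z - X z by rewrite -[z in z - _](bop_eqE XY z) addrC addKr.
by have := posop_rdot z pY; rewrite Yz rdotBl subr_ge0.
Qed.

End BoundedOps.

Section ConvergenceTheory.
Context {R : realType}.
Variables (H K : hilbertType R).
Implicit Types (u v : nat -> H) (l : H).

Lemma ncvgD u v l l' : ncvg u l -> ncvg v l' -> ncvg (fun n => u n + v n) (l + l').
Proof.
move=> ul vl e e0; have e2 : 0 < e / 2 by lra.
have [N hN] := ul _ e2; have [N' hN'] := vl _ e2.
exists (maxn N N') => n; rewrite geq_max => /andP[/hN h /hN' h'].
by rewrite opprD addrACA (le_lt_trans (nrmD _ _))//; lra.
Qed.

Lemma ncvg_bop (A : 'B(H, K)) u l : ncvg u l -> ncvg (A \o u) (A l).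
Proof.
move=> ul e e0; have [c c0 hc] := bop_bound A.
have [|N hN] := ul (e / c); first by rewrite divr_gt0.
exists N => n /hN; rewrite ltr_pdivlMr// mulrC => h.
by rewrite /= -bopB (le_lt_trans (hc _)).
Qed.

Lemma ncvgZ (a : R[i]) u l : ncvg u l -> ncvg (fun n => a *: u n) (a *: l).
Proof.
move=> ul e e0; have a0 : 0 <= complex.Re `|a|.
  by have := normr_ge0 a; rewrite lecE => /andP[].
have [|N hN] := ul (e / (complex.Re `|a| + 1)); first by rewrite divr_gt0//; lra.
exists N => n /hN; rewrite ltr_pdivlMr; last lra.
rewrite -scalerBr nrmZ; have := nrm_ge0 (u n - l); nra.
Qed.

Lemma ncvg_cst l : ncvg (fun=> l) l.
Proof. by move=> e e0; exists 0%N => n _; rewrite subrr nrm0. Qed.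

Lemma ncvg_shift u l : ncvg u l -> ncvg (fun n => u n.+1) l.
Proof. by move=> ul e /ul[N hN]; exists N => n Nn; apply: hN; exact: leqW. Qed.

Lemma ncvg_nrm_le u l (c : R) : ncvg u l -> (forall n, nrm (u n) <= c) -> nrm l <= c.
Proof.
move=> ul h; apply: le_eps => e /ul[N /(_ _ (leqnn _)) hN].
have : nrm l <= nrm (l - u N) + nrm (u N) by rewrite -{1}(subrK (u N) l) nrmD.
by rewrite nrmB; have := h N; lra.
Qed.

(** Makes the pointwise limit of symmetric operators symmetric. *)
Lemma ncvg_rdot u v l l' y z : ncvg u l -> ncvg v l' ->
  (forall n, rdot (u n) y = rdot (v n) z) -> rdot l y = rdot l' z.
Proof.
move=> ul vl h.
suff /eqP : `|rdot l y - rdot l' z| = 0 by rewrite normr_eq0 subr_eq0 => /eqP.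
apply/le_anti; rewrite normr_ge0 andbT; apply: le_eps => e e0; rewrite add0r.
have C0 : 0 < nrm y + nrm z + 1 by have := nrm_ge0 y; have := nrm_ge0 z; lra.
have d0 : 0 < e / (nrm y + nrm z + 1) by rewrite divr_gt0.
have [N hN] := ul _ d0; have [N' hN'] := vl _ d0.
have := hN _ (leq_maxl N N'); have := hN' _ (leq_maxr N N').
set n := maxn _ _; rewrite !ltr_pdivlMr// => h1 h2.
have abs (a b : H) : `|rdot a b| <= nrm a * nrm b.
  rewrite ler_norml rdot_le andbT lerNl -rdotNl -(nrmN a) rdot_le//.
have -> : rdot l y - rdot l' z = rdot (l - u n) y - rdot (l' - v n) z.
  by rewrite !rdotBl h; ring.
rewrite (le_trans (ler_normB _ _))//.
rewrite (le_trans (lerD (abs _ _) (abs _ _)))// !(nrmB l) (nrmB l').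
have := nrm_ge0 y; have := nrm_ge0 z.
have := nrm_ge0 (u n - l); have := nrm_ge0 (v n - l'); nra.
Qed.

End ConvergenceTheory.

(** * Square roots of positive operators *)

Section SquareRoot.
Context {R : realType}.
Variable H : hilbertType R.
Implicit Types (A B C : 'B(H)).

(** [pospoly C s A] says that [A = p(C)] and [s = p(1)] for a polynomial [p]
    with nonnegative coefficients.  If [C] is a contraction, then [s] bounds the
    norm of [A]; so the convergence of operator sequences reduces to that of the
    numerical sequences obtained at [C = 1]. *)
Inductive pospoly C : R -> 'B(H) -> Prop :=
| Pospoly0 : pospoly C 0 0
| PospolyX : pospoly C 1 C
| PospolyD s t A B : pospoly C s A -> pospoly C t B -> pospoly C (s + t) (A + B)
| PospolyM s t A B : pospoly C s A -> pospoly C t B -> pospoly C (s * t) (A *o B)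
| PospolyZ (r : R) s A : 0 <= r -> pospoly C s A -> pospoly C (r * s) (r%:C *: A).

Lemma pospoly_ge0 C s A : pospoly C s A -> 0 <= s.
Proof.
by elim=> *; rewrite ?ler01 ?addr_ge0 ?mulr_ge0.
Qed.

Lemma pospoly_nrm C s A : (forall x, nrm (C x) <= nrm x) -> pospoly C s A ->
  forall x, nrm (A x) <= s * nrm x.
Proof.
move=> C1; elim=> {s A} [x|x|s t A B _ hA _ hB x|s t A B pA hA _ hB x|r s A r0 _ hA x].
- by rewrite bop0E nrm0 mul0r.
- by rewrite mul1r.
- by rewrite bopDE mulrDl (le_trans (nrmD _ _))// lerD.
- by rewrite -mulrA (le_trans (hA _))// ler_wpM2l// (pospoly_ge0 pA).
- by rewrite bopZE nrmZr (ger0_norm r0) -mulrA ler_wpM2l.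
Qed.

(** Polynomials in [C] lie in the bicommutant of [C]. *)
Lemma pospoly_comm1 C s A D : C *o D = D *o C -> pospoly C s A -> A *o D = D *o A.
Proof.
move=> CD; elim=> {s A} //.
- by apply: bop_ext => x; rewrite -[LHS]/(0 : H) -[RHS]/(D 0) bop0.
- move=> s t A B _ hA _ hB; apply: bop_ext => x.
  rewrite -[LHS]/(A (D x) + B (D x)) -[RHS]/(D (A x + B x)) bopD.
  by rewrite (bop_eqE hA x : A (D x) = D (A x)) (bop_eqE hB x : B (D x) = D (B x)).
- by move=> s t A B _ hA _ hB; rewrite -bop_compA hB bop_compA hA bop_compA.
- move=> r s A _ _ hA; apply: bop_ext => x.
  rewrite -[LHS]/(r%:C *: A (D x)) -[RHS]/(D (r%:C *: A x)) bopZ.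
  by rewrite (bop_eqE hA x : A (D x) = D (A x)).
Qed.

Lemma pospoly_comm C s t A B : pospoly C s A -> pospoly C t B -> A *o B = B *o A.
Proof.
move=> pA pB; apply: (pospoly_comm1 _ pA); apply/esym.
exact: (pospoly_comm1 _ pB).
Qed.

Lemma pospoly_sym C s A : (forall x y, rdot (C x) y = rdot x (C y)) ->
  pospoly C s A -> forall x y, rdot (A x) y = rdot x (A y).
Proof.
move=> sC; elim=> {s A} //.
- by move=> x y; rewrite !bop0E rdot0l rdot0r.
- by move=> s t A B _ hA _ hB x y; rewrite !bopDE rdotDl rdotDr hA hB.
- move=> s t A B pA hA pB hB x y; rewrite [in LHS](pospoly_comm pA pB)/=.
  by rewrite hB hA.
- by move=> r s A _ _ hA x y; rewrite !bopZE rdotZl rdotZr hA.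
Qed.

(** Iteration for the solution [F] of [C + F^2 = 2 F], that is, of
    [(1 - F)^2 = 1 - C]. *)
Fixpoint sqrt_iter C n : 'B(H) :=
  if n is m.+1 then 2^-1%:C *: (C + sqrt_iter C m *o sqrt_iter C m) else 0.
Fixpoint sqrt_seq n : R :=
  if n is m.+1 then 2^-1 * (1 + sqrt_seq m * sqrt_seq m) else 0.

Lemma pospoly_iter C n : pospoly C (sqrt_seq n) (sqrt_iter C n).
Proof.
elim: n => [|n IH] /=; first exact: Pospoly0.
by apply: PospolyZ; rewrite ?invr_ge0//; apply: PospolyD (PospolyX C) (PospolyM IH IH).
Qed.

Lemma sqrt_seq_le1 n : sqrt_seq n <= 1.
Proof.
elim: n => [|n IH] /=; first exact: ler01.
have := pospoly_ge0 (pospoly_iter 0 n); nra.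
Qed.

(** The increment at [n + 1] is [(X' - X) (X' + X) / 2], a product of two
    polynomials with nonnegative coefficients. *)
Lemma pospoly_incr1 C n :
  pospoly C (sqrt_seq n.+1 - sqrt_seq n) (sqrt_iter C n.+1 - sqrt_iter C n).
Proof.
elim: n => [|n IH].
  have := pospoly_iter C 1.
  by rewrite -{1}(subr0 (sqrt_seq 1)) -{1}(subr0 (sqrt_iter C 1)).
set s := sqrt_seq n.+1 in IH *; set A := sqrt_iter C n.+1 in IH *.
have pA : pospoly C s A := pospoly_iter C n.+1.
have pB := pospoly_iter C n; set t := sqrt_seq n in IH pB *.
set B := sqrt_iter C n in IH pB *.
rewrite (_ : sqrt_seq n.+2 - s = 2^-1 * ((s - t) * (s + t))); last by rewrite /s/= -/s -/t; lra.
rewrite (_ : sqrt_iter C n.+2 - A = 2^-1%:C *: ((A - B) *o (A + B))).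
  by apply: PospolyZ; rewrite ?invr_ge0//; apply: PospolyM IH (PospolyD pA pB).
apply: bop_ext => x.
(* With [A] and [B] commuting, the product is the difference of squares. *)
have AB : A (B x) = B (A x).
  exact: (bop_eqE (pospoly_comm pA pB) x).
have Ax : A x = 2^-1%:C *: (C x + B (B x)) by [].
rewrite -[LHS]/(2^-1%:C *: (C x + A (A x)) - A x).
rewrite -[RHS]/(2^-1%:C *: (A (A x + B x) - B (A x + B x))).
rewrite [X in _ - X = _]Ax -scalerBr !bopD AB; congr (_ *: _).
by rewrite !opprD addrACA subrr add0r addrA addrK.
Qed.

Lemma pospoly_incr C m n : (m <= n)%N ->
  pospoly C (sqrt_seq n - sqrt_seq m) (sqrt_iter C n - sqrt_iter C m).
Proof.
elim: n => [|n IH]; first by rewrite leqn0 => /eqP->; rewrite !subrr; exact: Pospoly0.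
rewrite leq_eqVlt => /predU1P[->|]; first by rewrite !subrr; exact: Pospoly0.
rewrite ltnS => /IH p; have := PospolyD (pospoly_incr1 C n) p.
by rewrite !addrA !subrK.
Qed.

Lemma sqrt_seq_cauchy (e : R) : 0 < e -> exists N, forall m n, (N <= m)%N -> (m <= n)%N ->
  sqrt_seq n - sqrt_seq m < e.
Proof.
move=> e0.
have hs : has_sup (range sqrt_seq).
  by split; [exists 0, 0%N|exists 1 => _ [n _ <-]; exact: sqrt_seq_le1].
have [_ [N _ <-] hN] := sup_adherent e0 hs; exists N => m n Nm mn.
have : sqrt_seq n <= sup (range sqrt_seq) by apply: ub_le_sup; [exact: hs.2|exists n].
by have := pospoly_ge0 (pospoly_incr 0 Nm); lra.
Qed.

(** The numerical iterates increase and stay below 1, so they form a Cauchy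
    sequence; by [pospoly_nrm] the operator iterates converge pointwise. *)
Lemma sqrt_fixpoint C : (forall x y, rdot (C x) y = rdot x (C y)) ->
  (forall x, nrm (C x) <= nrm x) ->
  exists F : 'B(H), [/\ forall x, nrm (F x) <= nrm x,
    forall x y, rdot (F x) y = rdot x (F y),
    forall x, C x + F (F x) = 2%:C *: F x &
    forall D, C *o D = D *o C -> F *o D = D *o F].
Proof.
move=> sC C1; pose X := sqrt_iter C.
have Xlim x : exists l, ncvg (fun n => X n x) l.
  apply: ncvg_cauchy => e e0.
  have x1 : 0 < nrm x + 1 by have := nrm_ge0 x; lra.
  have [N hN] := sqrt_seq_cauchy (divr_gt0 e0 x1); exists N => m n.
  have step k j : (N <= k)%N -> (k <= j)%N -> nrm (X j x - X k x) < e.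
    move=> Nk kj; have := hN _ _ Nk kj; rewrite ltr_pdivlMr// => h.
    have := pospoly_nrm C1 (pospoly_incr C kj) x; rewrite bopBE.
    have := pospoly_ge0 (pospoly_incr C kj); have := nrm_ge0 x.
    move: h; rewrite /X; move: (_ - _) (nrm _) (nrm _) => *; nra.
  move=> Nm Nn; have [mn|/ltnW nm] := leqP m n; last exact: step.
  by rewrite nrmB; exact: step.
have [f hf] := boolp.choice Xlim.
have f1 x : nrm (f x) <= 1 * nrm x.
  apply: (ncvg_nrm_le (hf x)) => n.
  rewrite (le_trans (pospoly_nrm C1 (pospoly_iter C n) _))//.
  by rewrite ler_wpM2r ?nrm_ge0// sqrt_seq_le1.
have lf : linear f.
  move=> a x y; apply: (ncvg_uniq (hf _)).
  have := ncvgD (ncvgZ a (hf x)) (hf y).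
  by under [X in ncvg X]eq_fun do rewrite -bopP.
have [F FE] := bop_of_bound lf f1; exists F; split.
- by move=> x; rewrite FE -[leRHS]mul1r.
- move=> x y; rewrite !FE [RHS]rdotC; apply: (ncvg_rdot (hf x) (hf y)) => n.
  by rewrite (pospoly_sym sC (pospoly_iter C n)) rdotC.
2: { move=> D CD; apply: bop_ext => x; rewrite /= !FE.
  apply: (ncvg_uniq (hf (D x))); have := ncvg_bop D (hf x).
  rewrite (_ : _ \o _ = fun n => X n (D x))//; apply/funext => n /=.
  exact/esym/(bop_eqE (pospoly_comm1 CD (pospoly_iter C n)) x). }
move=> x; rewrite !FE.
have XX : ncvg (fun n => X n (X n x)) (f (f x)).
  move=> e e0; have e2 : 0 < e / 2 by lra.
  have [N hN] := hf x _ e2; have [N' hN'] := hf (f x) _ e2.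
  exists (maxn N N') => n; rewrite geq_max => /andP[/hN h /hN' h'].
  rewrite (le_lt_trans (nrm_dist _ (X n (f x)) _))// -bopB.
  have /le_lt_trans/(_ h) : nrm (X n (X n x - f x)) <= nrm (X n x - f x).
    rewrite (le_trans (pospoly_nrm C1 (pospoly_iter C n) _))//.
    by rewrite -[leRHS]mul1r ler_wpM2r ?nrm_ge0// sqrt_seq_le1.
  by lra.
have := ncvgD (ncvg_cst (C x)) XX.
have := ncvgZ 2%:C (ncvg_shift (hf x)).
rewrite (_ : (fun _ => _) = (fun n => C x + X n (X n x))); last first.
  apply/funext => n.
  rewrite -[LHS]/(2%:C *: (2^-1%:C *: (C x + X n (X n x)))) scalerA -rmorphM mulfV//.
  by rewrite scale1r.
by move=> h h'; apply: ncvg_uniq h' h.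
Qed.

(** With [c] a bound of [A], [C = 1 - A / c] is a positive contraction, and
    [sqrt c (1 - F)] is a root of [A] when [F] is the limit above.  It commutes
    with the commutant of [A], which is what uniqueness needs. *)
Lemma posop_sqrt A : posop A -> exists B,
  [/\ posop B, B *o B = A & forall D, A *o D = D *o A -> B *o D = D *o B].
Proof.
move=> pA; have [c c0 hc] := bop_bound A.
pose C : 'B(H) := 1%:B - c^-1%:C *: A.
have CE x : C x = x - c^-1%:C *: A x by [].
have sC x y : rdot (C x) y = rdot x (C y).
  by rewrite !CE rdotBl rdotBr rdotZl rdotZr posop_sym.
have Ale x : rdot (A x) x <= c * nrm x ^+ 2.
  by rewrite (le_trans (rdot_le _ _))// expr2 mulrA ler_wpM2r ?nrm_ge0.
have pC : posop C.
  apply: posop_intro => // x; rewrite CE rdotBl rdotZl -nrm_sqr subr_ge0.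
  by rewrite mulrC ler_pdivrMr// mulrC Ale.
have C1 x : nrm (C x) <= nrm x.
  rewrite -[leRHS]mul1r; apply: posop_le_nrm => // z.
  rewrite CE rdotBl rdotZl -nrm_sqr mul1r gerBl mulr_ge0//.
    by rewrite invr_ge0 ltW.
  exact: posop_rdot.
have [F [F1 sF FF cF]] := sqrt_fixpoint sC C1.
pose B : 'B(H) := (Num.sqrt c)%:C *: (1%:B - F).
have BE x : B x = (Num.sqrt c)%:C *: (x - F x) by [].
exists B; split.
  apply: posop_intro => [x y|x]; rewrite !BE.
    by rewrite rdotZl rdotZr rdotBl rdotBr sF.
  rewrite rdotZl mulr_ge0 ?sqrtr_ge0// rdotBl -nrm_sqr subr_ge0.
  by rewrite (le_trans (rdot_le _ _))// expr2 ler_wpM2r ?nrm_ge0.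
2: { move=> D AD; apply: bop_ext => x; rewrite -[LHS]/(B (D x)) -[RHS]/(D (B x)).
  rewrite !BE bopZ bopB (bop_eqE (cF D _) x : F (D x) = D (F x))//.
  apply: bop_ext => y; rewrite -[LHS]/(C (D y)) -[RHS]/(D (C y)) !CE bopB bopZ.
  by rewrite (bop_eqE AD y : A (D y) = D (A y)). }
apply: bop_ext => x; rewrite -[LHS]/(B (B x)) !BE !bopZ bopB -scalerBr scalerA.
rewrite -rmorphM -expr2 sqr_sqrtr ?ltW//.
have -> : x - F x - (F x - F (F x)) = x - C x.
  have -> : C x = F x + F x - F (F x).
    have := FF x; rewrite (rmorphD (real_complex R) 1 1) scalerDl rmorph1.
    by rewrite scale1r => <-; rewrite addrK.
  by rewrite !opprD !opprK !addrA.
by rewrite CE opprB addrC subrK scalerA -rmorphM mulfV ?gt_eqF// scale1r.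
Qed.

Lemma sqrtopP A : posop A -> posop (sqrtop A) /\ sqrtop A *o sqrtop A = A.
Proof.
by move=> /posop_sqrt[B [pB BB _]]; apply: (@xgetPex _ _ [set B | posop B /\ B *o B = A]); exists B.
Qed.

(** [B] commutes with [A = B^2], hence with [B'], so that [(B + B') (B - B') = 0].
    On [y = (B - B') x] the forms of [B] and [B'] are nonnegative with sum zero;
    hence [B y = B' y = 0], and [|y|^2 = <x, (B - B') y> = 0]. *)
Lemma sqrt_uniq A B B' : posop B -> posop B' -> B *o B = A -> B' *o B' = A ->
  (forall D, A *o D = D *o A -> B' *o D = D *o B') -> B = B'.
Proof.
move=> pB pB' BB BB' cB'.
have comm : B' *o B = B *o B' by apply: cB'; rewrite -BB bop_compA.
apply: bop_ext => x; apply/eqP; rewrite -subr_eq0; apply/eqP.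
set y := B x - B' x.
have h0 : B y + B' y = 0.
  rewrite !bopB (bop_eqE comm x : B' (B x) = B (B' x)).
  rewrite (bop_eqE BB x : B (B x) = A x) (bop_eqE BB' x : B' (B' x) = A x).
  by rewrite addrA subrK subrr.
have B0 (D : 'B(H)) : posop D -> rdot (D y) y = 0 -> D y = 0.
  move=> pD Dy; apply/nrm_eq0/eqP; rewrite -sqrf_eq0 -[_ ^+ 2 == 0]sqrf_eq0 nrm_sqr.
  apply/eqP/le_anti; rewrite sqr_ge0 andbT (le_trans (posop_CS _ _ pD))//.
  by rewrite Dy mul0r.
have h : rdot (B y) y + rdot (B' y) y = 0 by rewrite -rdotDl h0 rdot0l.
have p1 := posop_rdot y pB; have p2 := posop_rdot y pB'.
have By : B y = 0 by apply: B0 => //; move: (rdot _ _) (rdot _ _) h p1 p2 => *; lra.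
have B'y : B' y = 0 by apply: B0 => //; move: (rdot _ _) (rdot _ _) h p1 p2 => *; lra.
apply/nrm_eq0/eqP; rewrite -sqrf_eq0 nrm_sqr {1}/y rdotBl.
by rewrite (posop_sym x y pB) (posop_sym x y pB') By B'y subrr.
Qed.

(** [sqrtop A] is an arbitrarily chosen positive root, so that commutation comes
    from its uniqueness. *)
Lemma sqrtop_comm A D : posop A -> A *o D = D *o A ->
  sqrtop A *o D = D *o sqrtop A.
Proof.
move=> pA AD; have [pS SS] := sqrtopP pA; have [B [pB BB cB]] := posop_sqrt pA.
by rewrite (sqrt_uniq pS pB SS BB cB) cB.
Qed.

End SquareRoot.

(** * Operators determined on dense subsets *)

Section Density.
Context {R : realType}.
Implicit Types H K L : hilbertType R.

Definition dense_in H (P : H -> Prop) : Prop :=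
  forall x (e : R), 0 < e -> exists2 u, P u & nrm (x - u) < e.

Lemma dense_rdot H (P : H -> Prop) x y : dense_in P ->
  (forall u, P u -> rdot x u = rdot y u) -> x = y.
Proof.
move=> dP h; apply/eqP; rewrite -subr_eq0; apply/eqP/nrm_eps0 => e e0.
have [u Pu ue] := dP (x - y) e e0.
have z0 := nrm_ge0 (x - y).
have : nrm (x - y) ^+ 2 <= nrm (x - y) * e.
  have -> : nrm (x - y) ^+ 2 = rdot (x - y) (x - y - u).
    rewrite nrm_sqr [RHS]rdotBr (_ : rdot _ u = 0) ?subr0//.
    by rewrite rdotBl h// subrr.
  by rewrite (le_trans (rdot_le _ _))// ler_wpM2l// ltW.
by rewrite leNgt => /negP h2; rewrite leNgt; apply/negP => ez; apply: h2; nra.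
Qed.

Lemma dense_bop H K (P : H -> Prop) (X Y : 'B(H, K)) : dense_in P ->
  (forall u, P u -> X u = Y u) -> X = Y.
Proof.
move=> dP h; suff : X^*o = Y^*o by move=> /(congr1 (@adjoint _ _ _)); rewrite !adjointK.
apply: bop_ext => y; apply: (dense_rdot dP) => u Pu.
by rewrite !adjoint_rdotr h.
Qed.

(** The continuous extension of a densely defined bounded operator given by its
    graph. *)
Lemma extend_graph H K (P : H -> K -> Prop) (c : R) : 0 <= c ->
  (forall (a : R[i]) u v u' v', P u v -> P u' v' -> P (a *: u + u') (a *: v + v')) ->
  (forall u v, P u v -> nrm v <= c * nrm u) ->
  dense_in (fun u => exists v, P u v) ->
  exists W : 'B(H, K), forall u v, P u v -> W u = v.
Proof.
move=> c0 PP Pc Pd.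
(* [Q] is the closure of the graph. *)
pose Q x y := exists u v, [/\ forall n, P (u n) (v n), ncvg u x & ncvg v y].
have QQ a x y x' y' : Q x y -> Q x' y' -> Q (a *: x + x') (a *: y + y').
  move=> [u [v [Puv ux vy]]] [u' [v' [Puv' ux' vy']]].
  exists (fun n => a *: u n + u' n), (fun n => a *: v n + v' n); split.
  - by move=> n; apply: PP.
  - exact: ncvgD (ncvgZ a ux) ux'.
  - exact: ncvgD (ncvgZ a vy) vy'.
have Qc x y : Q x y -> nrm y <= c * nrm x.
  move=> [u [v [Puv ux vy]]]; apply: le_eps => e e0.
  have c1 : 0 < c + 1 by lra.
  have d0 : 0 < e / (c + 1) by rewrite divr_gt0.
  have [N hN] := ux _ d0; have [N' hN'] := vy _ d0.
  have := hN _ (leq_maxl N N'); have := hN' _ (leq_maxr N N').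
  set n := maxn _ _; rewrite !ltr_pdivlMr// => h1 h2.
  have h3 : nrm y <= nrm (v n - y) + nrm (v n) by rewrite nrmB -{1}(subrK (v n) y) nrmD.
  have h4 : nrm (u n) <= nrm (u n - x) + nrm x by rewrite -{1}(subrK x (u n)) nrmD.
  have := Pc _ _ (Puv n); nra.
have Qu x y y' : Q x y -> Q x y' -> y = y'.
  move=> h h'; have := Qc _ _ (QQ (-1) _ _ _ _ h h').
  rewrite !scaleN1r addNr nrm0 mulr0 => h0.
  apply/esym/eqP; rewrite -subr_eq0 addrC; apply/eqP/nrm_eq0/le_anti.
  by rewrite h0 nrm_ge0.
have Qex x : exists y, Q x y.
  have inv0 n : 0 < (n.+1%:R^-1 : R) by rewrite invr_gt0.
  have /boolp.choice[u hu] n : exists u, (exists v, P u v) /\ nrm (x - u) < n.+1%:R^-1.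
    by have [u Pu xu] := Pd x _ (inv0 n); exists u.
  have /boolp.choice[v hv] : forall n, exists v, P (u n) v by move=> n; exact: (hu n).1.
  have ux : ncvg u x.
    move=> e e0; have [N _ /(_ N (leqnn _)) hN] := near_infty_natSinv_lt (PosNum e0).
    exists N => n Nn; rewrite nrmB (lt_trans (hu n).2)// (le_lt_trans _ hN)//.
    by rewrite lef_pV2 ?posrE// ler_nat.
  have [y vy] : exists y, ncvg v y.
    apply: ncvg_cauchy => e e0.
    have d0 : 0 < e / (2 * (c + 1)) by rewrite divr_gt0//; lra.
    have [N hN] := ux _ d0; exists N => m n Nm Nn.
    have := Pc _ _ (PP (-1) _ _ _ _ (hv n) (hv m)).
    rewrite !scaleN1r ![- _ + _]addrC => h.
    have := hN _ Nm; have := hN _ Nn; rewrite !ltr_pdivlMr; try lra.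
    have := nrm_dist (u m) x (u n); rewrite (nrmB x).
    have := nrm_ge0 (u m - u n); have := nrm_ge0 (u m - x); have := nrm_ge0 (u n - x).
    by move: h; move: (nrm _) (nrm _) (nrm _) (nrm _) => p q r s *; nra.
  by exists y, u, v; split.
have [f hf] := boolp.choice Qex.
have lf : linear f by move=> a x y; apply: (Qu _ _ _ (hf _)); apply: QQ.
have [W WE] := bop_of_bound lf (fun x => Qc _ _ (hf x)).
exists W => u v Puv; rewrite WE; apply: (Qu _ _ _ (hf _)).
by exists (fun=> u), (fun=> v); split=> // [e e0|e e0]; exists 0%N => n _; rewrite subrr nrm0.
Qed.

End Density.

(** * Closed subspaces *)

Section Inclusion.
Context {R : realType}.
Variables (K : hilbertType R) (L : closed_subspace K).

Lemma inclusion_subproof : (@csub_val R K L : csub L -> K) \in bop_pred (csub L) K.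
Proof. by apply/asboolP; split=> //; exists 1 => x; rewrite mul1r. Qed.

Definition inclusion : 'B(csub L, K) := Bop inclusion_subproof.

Lemma rdot_inclusion (x y : csub L) : rdot (inclusion x) (inclusion y) = rdot x y.
Proof. by []. Qed.

Lemma nrm_inclusion (x : csub L) : nrm (inclusion x) = nrm x.
Proof. by []. Qed.

Lemma inclusion_inj (x y : csub L) : inclusion x = inclusion y -> x = y.
Proof. exact: val_inj. Qed.

(** The adjoint of the inclusion is the orthogonal projection onto [L]. *)
Lemma inclusion_adjK x : csub_set L x -> inclusion (inclusion^*o x) = x.
Proof.
move=> Lx; have Lx' : x \in csub_pred L by rewrite inE.
suff -> : inclusion^*o x = Csub Lx' by [].
by apply: rdot_ext => z; rewrite adjoint_rdotr -rdot_inclusion.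
Qed.

Lemma inclusionK : inclusion^*o *o inclusion = 1%:B.
Proof.
apply: bop_ext => x; apply: inclusion_inj; rewrite inclusion_adjK//.
by have := csub_valP x; rewrite inE.
Qed.

(** The range of a positive operator [S] is contained in the closure of the
    range of [S S]: the component of [S z] orthogonal to that closure is
    annihilated by [S]. *)
Lemma closure_range_sqr (S : 'B(K)) z : posop S ->
  (forall x, csub_set L (S (S x))) -> csub_set L (S z).
Proof.
move=> pS LSS; pose p := inclusion^*o (S z); pose w := S z - inclusion p.
have wL l : rdot w (inclusion l) = 0.
  by rewrite rdotBl rdot_inclusion adjoint_rdotr subrr.
have Sw : S w = 0.
  apply/nrm_eq0/eqP; rewrite -sqrf_eq0 nrm_sqr -posop_sym// rdotC.
  by rewrite -(inclusion_adjK (LSS w)) wL.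
have w0 : w = 0.
  apply/nrm_eq0/eqP; rewrite -sqrf_eq0 nrm_sqr {2}/w rdotBr wL.
  by rewrite -posop_sym// Sw rdot0l subrr.
have -> : S z = inclusion p by apply/eqP; rewrite -subr_eq0 -/w w0.
by have := csub_valP p; rewrite inE.
Qed.

End Inclusion.

(** * The pair (R, S) of two positive operators *)

Section Quotient.
Context {R : realType}.
Variables (K : hilbertType R) (A B : 'B(K)).
Hypotheses (pA : posop A) (pB : posop B).
Let C := A + B.
Let L := closed_range C.

Lemma posopD : posop C.
Proof.
apply: posop_intro => [x y|x]; rewrite bopDE.
  by rewrite rdotDl rdotDr !posop_sym.
by rewrite rdotDl addr_ge0// posop_rdot.
Qed.

(** The operator [T] of [pw_calculus], the corestriction of the root of [A + B]. *)
Definition pwT : 'B(K, csub L) :=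
  xget 0 [set T : 'B(K, csub L) | forall z, csub_val (T z) = sqrtop C z].

Lemma pwTE z : inclusion L (pwT z) = sqrtop C z.
Proof.
have [pS SS] := sqrtopP posopD.
suff : [set T : 'B(K, csub L) | forall z, csub_val (T z) = sqrtop C z] pwT by exact.
apply: xgetPex; exists ((inclusion L)^*o *o sqrtop C) => {}z /=.
apply: inclusion_adjK; apply: closure_range_sqr => // x.
apply: subset_closure; exists x => //=; exact/esym/(bop_eqE SS x).
Qed.

Lemma pwT_gram : pwT^*o *o pwT = C.
Proof.
have [pS SS] := sqrtopP posopD.
apply: bop_ext => x; apply: rdot_ext => y.
rewrite -[LHS]/(rdot (pwT^*o (pwT x)) y) adjoint_rdotr -rdot_inclusion !pwTE.
by rewrite -posop_sym// (bop_eqE SS x : sqrtop C (sqrtop C x) = C x).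
Qed.

Lemma nrm_pwT x : nrm (pwT x) ^+ 2 = rdot (C x) x.
Proof. by rewrite nrm_sqr -adjoint_rdotr -(bop_eqE pwT_gram x). Qed.

(** [T] maps [sqrtop C z] to [C z], and the vectors [C z] are dense by the
    definition of the space. *)
Lemma pwT_dense : dense_in (range pwT).
Proof.
have [pS SS] := sqrtopP posopD.
move=> l e e0; have := csub_valP l; rewrite inE => /closure_nrm/(_ _ e0)[_ [z _ <-] h].
exists (pwT (sqrtop C z)); first by exists (sqrtop C z).
rewrite -nrm_inclusion bopB pwTE.
by rewrite (bop_eqE SS z : sqrtop C (sqrtop C z) = C z).
Qed.

Lemma pwT_sandwich_inj (X Y : 'B(csub L)) :
  pwT^*o *o X *o pwT = pwT^*o *o Y *o pwT -> X = Y.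
Proof.
move=> XY; apply: (dense_bop pwT_dense) => _ [z _ <-].
apply: (dense_rdot pwT_dense) => _ [w _ <-].
by rewrite -!adjoint_rdotr (bop_eqE XY z : pwT^*o (X (pwT z)) = pwT^*o (Y (pwT z))).
Qed.

(** As [|sqrt(D) z| <= |T z|], the assignment [T z |-> sqrt(D) z] extends to a
    bounded operator [W]; then [W^* W] is the derivative of [D]. *)
Lemma pw_derivative (D : 'B(K)) : posop D ->
  (forall x, rdot (D x) x <= rdot (C x) x) ->
  exists2 X : 'B(csub L), posop X & D = pwT^*o *o X *o pwT.
Proof.
move=> pD DC; have [pS SS] := sqrtopP pD; set S := sqrtop D in pS SS.
have [W hW] : exists W : 'B(csub L, K), forall u v,
    (exists z, u = pwT z /\ v = S z) -> W u = v.
  apply: (extend_graph ler01).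
  - move=> a _ _ _ _ [z [-> ->]] [w [-> ->]].
    by exists (a *: z + w); rewrite !bopP.
  - move=> _ _ [z [-> ->]]; rewrite mul1r -(@ler_pXn2r _ 2) ?nnegrE ?nrm_ge0//.
    rewrite nrm_pwT nrm_sqr -posop_sym//.
    by rewrite (bop_eqE SS z : S (S z) = D z).
  - move=> l e /(pwT_dense l)[_ [z _ <-] h]; exists (pwT z) => //.
    by exists (S z), z.
exists (W^*o *o W); first exact: posop_gram.
apply: bop_ext => x; apply: rdot_ext => y.
rewrite -[RHS]/(rdot (pwT^*o (W^*o (W (pwT x)))) y) !adjoint_rdotr.
have WT z : W (pwT z) = S z by apply: hW; exists z.
by rewrite !WT -posop_sym// (bop_eqE SS x : S (S x) = D x).
Qed.

Definition pwRS : 'B(csub L) * 'B(csub L) := xget (0, 0) [set RS : 'B(csub L) * 'B(csub L) |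
    [/\ posop RS.1, posop RS.2, A = pwT^*o *o RS.1 *o pwT,
        B = pwT^*o *o RS.2 *o pwT & RS.1 + RS.2 = 1%:B]].

(** The derivatives of [A] and [B] exist since both are dominated by [A + B];
    they sum to the identity because the range of [T] is dense. *)
Lemma pwRSP : [/\ posop pwRS.1, posop pwRS.2, A = pwT^*o *o pwRS.1 *o pwT,
        B = pwT^*o *o pwRS.2 *o pwT & pwRS.1 + pwRS.2 = 1%:B].
Proof.
suff : [set RS : 'B(csub L) * 'B(csub L) |
    [/\ posop RS.1, posop RS.2, A = pwT^*o *o RS.1 *o pwT,
        B = pwT^*o *o RS.2 *o pwT & RS.1 + RS.2 = 1%:B]] pwRS by exact.
apply: xgetPex.
have [|X pX XA] := pw_derivative pA.
  by move=> x; rewrite bopDE rdotDl lerDl posop_rdot.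
have [|Y pY YB] := pw_derivative pB.
  by move=> x; rewrite bopDE rdotDl lerDr posop_rdot.
exists (X, Y); split=> //=; apply: pwT_sandwich_inj.
transitivity C; last by rewrite -pwT_gram; exact: bop_ext.
rewrite /C XA YB; apply: bop_ext => x.
by rewrite -[LHS]/(pwT^*o (X (pwT x) + Y (pwT x))) bopD.
Qed.

Lemma pw_calculusE (f : R -> R) :
  pw_calculus f A B = compress pwT (pw_calculus1 f pwRS.1).
Proof. by []. Qed.

End Quotient.

(** * Passing to a minimal realization of the pair *)

Section Reduction.
Context {R : realType}.
Implicit Types H K L : hilbertType R.

Lemma compress_comp H K L (V : 'B(H, K)) (T : 'B(K, L)) m :
  compress V (compress T m) = compress (T *o V) m.
Proof.
apply/funext => omega; rewrite /compress; congr m; apply/funext => X.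
by congr omega; rewrite adjoint_comp !bop_compA.
Qed.

Lemma bop_sum H K (T : 'B(H, K)) n (F : 'I_n -> H) :
  T (\sum_i F i) = \sum_i T (F i).
Proof. by apply: (big_morph T (bopD T) (bop0 T)). Qed.

Lemma dense_closure H (S : set H) : closure S = setT <-> dense_in S.
Proof.
split=> [h x|h]; first by apply/closure_nrm; rewrite h.
by apply/seteqP; split=> // x _; apply/closure_nrm; exact: h.
Qed.

Lemma dense_image H K (S : set H) (T : 'B(H, K)) :
  dense_in S -> dense_in (range T) -> dense_in (T @` S).
Proof.
move=> dS dT y e e0; have e2 : 0 < e / 2 by lra.
have [_ [x _ <-] yx] := dT y _ e2; have [c c0 hc] := bop_bound T.
have [s Ss xs] := dS x _ (divr_gt0 e2 c0).
exists (T s); first by exists s.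
rewrite (le_lt_trans (nrm_dist _ (T x) _))// -bopB.
move: xs; rewrite ltr_pdivlMr// mulrC => xs.
by have := hc (x - s); lra.
Qed.

Variables (H0 H K : hilbertType R) (M : set 'B(H0)) (vnM : von_neumann M).
Variables (Gamma Phi Psi : 'B(H0) -> 'B(H)) (pi : 'B(H0) -> 'B(K)) (V : 'B(H, K)).
Variables (A B : 'B(K)).
Hypothesis minV : minimal_stinespring M Gamma pi V.
Hypotheses (RNA : RN_derivative M Phi pi V A) (RNB : RN_derivative M Psi pi V B).

Let pA : posop A. Proof. by case: RNA. Qed.
Let pB : posop B. Proof. by case: RNB. Qed.
Let T := pwT A B.
Let L := csub (closed_range (A + B)).
Let i : 'B(L, K) := inclusion (closed_range (A + B)).

(** The restriction of [pi x] to the closed range of [A + B].  Its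
    invariance under [pi x] is known for [x] in [M] only; written as a
    compression, the restriction makes sense for all [x]. *)
Definition pi_quotient (x : 'B(H0)) : 'B(csub (closed_range (A + B))) :=
  (inclusion (closed_range (A + B)))^*o *o pi x *o inclusion (closed_range (A + B)).

Let pi_comm x : M x -> (A + B) *o pi x = pi x *o (A + B).
Proof.
move=> Mx; have [cA _ _] := RNA; have [cB _ _] := RNB.
have pix : (pi @` M) (pi x) by exists x.
apply: bop_ext => z.
rewrite -[LHS]/(A (pi x z) + B (pi x z)) -[RHS]/(pi x (A z + B z)) bopD.
by rewrite (bop_eqE (cA _ pix) z : pi x (A z) = _) (bop_eqE (cB _ pix) z : pi x (B z) = _).
Qed.

Lemma pi_quotientE x l : M x -> i (pi_quotient x l) = pi x (i l).
Proof.
move=> Mx; apply: inclusion_adjK; apply/closure_nrm => e e0.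
have [c c0 hc] := bop_bound (pi x).
have := csub_valP l; rewrite inE => /closure_nrm/(_ _ (divr_gt0 e0 c0))[_ [z _ <-]].
rewrite ltr_pdivlMr// mulrC => h.
exists ((A + B) (pi x z)); first by exists (pi x z).
rewrite (bop_eqE (pi_comm Mx) z : (A + B) (pi x z) = pi x ((A + B) z)) -bopB.
by rewrite (le_lt_trans (hc _)).
Qed.

(** [T] intertwines the two representations because the square root of [A + B]
    commutes with everything that commutes with [A + B]. *)
Lemma pi_quotient_pwT x : M x -> pi_quotient x *o T = T *o pi x.
Proof.
move=> Mx; apply: bop_ext => z; apply: inclusion_inj.
rewrite -[RHS]/(i (T (pi x z))) -[LHS]/(i (pi_quotient x (T z))) pi_quotientE//.
rewrite /i /T !pwTE//.
exact/esym/(bop_eqE (sqrtop_comm (posopD pA pB) (pi_comm Mx)) z).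
Qed.

(** [(T V)^* piL(x) (T V) = V^* T^* T pi(x) V = V^* (A + B) pi(x) V], and [T] maps
    a dense span onto a dense span. *)
Lemma quotient_stinespring :
  minimal_stinespring M (fun x => Phi x + Psi x) pi_quotient (T *o V).
Proof.
have [M1 MP MM Ms _] := vnM; have [[pi1 piP piM pis] _ pid] := minV.
have [_ _ hA] := RNA; have [_ _ hB] := RNB.
split.
- split.
  + rewrite /pi_quotient pi1; apply: etrans (inclusionK (closed_range (A + B))).
    exact: bop_ext.
  + move=> a x y Mx My; apply: bop_ext => l; apply: inclusion_inj.
    rewrite pi_quotientE ?piP//; last exact: MP.
    rewrite -[RHS]/(i (a *: pi_quotient x l + pi_quotient y l)) bopP.
    by rewrite !pi_quotientE.
  + move=> x y Mx My; apply: bop_ext => l; apply: inclusion_inj.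
    rewrite pi_quotientE ?piM//; last exact: MM.
    by rewrite -[RHS]/(i (pi_quotient x (pi_quotient y l))) !pi_quotientE.
  + move=> x Mx; rewrite /pi_quotient pis// !adjoint_comp adjointK.
    by rewrite bop_compA.
- move=> x Mx; rewrite hA// hB// adjoint_comp.
  transitivity (V^*o *o (T^*o *o T) *o pi x *o V).
    rewrite /T pwT_gram//; apply: bop_ext => z.
    rewrite -[LHS]/(V^*o (A (pi x (V z))) + V^*o (B (pi x (V z)))).
    by rewrite -bopD.
  by rewrite -!bop_compA (bop_compA T) -pi_quotient_pwT// !bop_compA.
- apply/dense_closure; move/dense_closure : pid => pid.
  have := dense_image pid (pwT_dense pA pB).
  move=> h x e e0; have [_ [_ [n [a [s [hs ->]]]] <-] hx] := h x e e0.
  exists (pwT A B (\sum_i0 a i0 *: s i0)) => //; exists n, a, (fun j => T (s j)); split.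
    move=> j; have [x0 Mx0 [h0 _ <-]] := hs j.
    exists x0 => //; exists h0 => //.
    exact: (bop_eqE (pi_quotient_pwT Mx0) (V h0)).
  by rewrite bop_sum; apply: eq_bigr => j _; rewrite bopZ.
Qed.

(** Commutation with [piL] can be tested under [T^* _ T], where it becomes the
    commutation of [D = T^* X T] with [pi]. *)
Lemma quotient_derivative (Theta : 'B(H0) -> 'B(H)) (D : 'B(K)) (X : 'B(L)) :
  RN_derivative M Theta pi V D -> posop X -> D = T^*o *o X *o T ->
  RN_derivative M Theta pi_quotient (T *o V) X.
Proof.
have [M1 MP MM Ms _] := vnM; have [[pi1 piP piM pis] _ pid] := minV.
move=> [cD _ hD] pX DX; split=> //.
- move=> _ [x Mx <-]; apply: (pwT_sandwich_inj pA pB); rewrite -/T.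
  have Txs : T^*o *o pi_quotient x = pi x *o T^*o.
    apply: bop_ext => z; apply: rdot_ext => w.
    rewrite -[LHS]/(rdot (T^*o (pi_quotient x z)) w) adjoint_rdotr.
    rewrite -[RHS]/(rdot (pi x (T^*o z)) w) adjoint_rdot -pis// adjoint_rdotr.
    have <- : pi_quotient x^*o (T w) = T (pi x^*o w).
      exact: (bop_eqE (pi_quotient_pwT (Ms _ Mx)) w).
    rewrite -!rdot_inclusion !pi_quotientE//; last exact: Ms.
    by rewrite pis// -adjoint_rdot.
  have pix : (pi @` M) (pi x) by exists x.
  apply: bop_ext => z.
  rewrite -[LHS]/(T^*o (pi_quotient x (X (T z)))).
  rewrite -[RHS]/(T^*o (X (pi_quotient x (T z)))).
  have -> : pi_quotient x (T z) = T (pi x z) := bop_eqE (pi_quotient_pwT Mx) z.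
  rewrite (bop_eqE Txs (X (T z)) : T^*o (pi_quotient x _) = pi x (T^*o _)).
  rewrite -[LHS]/(pi x ((T^*o *o X *o T) z)) -[RHS]/((T^*o *o X *o T) (pi x z)) -DX.
  exact: (bop_eqE (cD _ pix) z).
- move=> x Mx; rewrite hD// DX adjoint_comp; apply: bop_ext => z.
  rewrite -[LHS]/(V^*o (T^*o (X (T (pi x (V z)))))).
  rewrite -[RHS]/(V^*o (T^*o (X (pi_quotient x (T (V z)))))).
  by rewrite (bop_eqE (pi_quotient_pwT Mx) (V z) : pi_quotient x (T _) = T (pi x _)).
Qed.

End Reduction.

(** * Projection-valued measures *)

(** The integral is defined through simple functions, so that it sees a set
    function only through its measurable sets.  Spectral families are arbitrary
    on the other sets. *)
Lemma eq_integral_measurable d (T : measurableType d) (R : realType)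
    (m1 m2 : set T -> \bar R) (D : set T) (f : T -> \bar R) :
  (forall X, measurable X -> m1 X = m2 X) ->
  (\int[m1]_(x in D) f x = \int[m2]_(x in D) f x)%E.
Proof.
move=> m12; rewrite /integral.
suff E g : [set sintegral m1 h | h in [set h : {nnsfun T >-> R} | forall x, ((h x)%:E <= g x)%E]] =
   [set sintegral m2 h | h in [set h : {nnsfun T >-> R} | forall x, ((h x)%:E <= g x)%E]]
  by rewrite !E.
have sE (h : {nnsfun T >-> R}) : sintegral m1 h = sintegral m2 h.
  by apply: eq_fsbigr => r _; congr (_ * _)%E; apply: m12; exact: measurable_sfunP.
by apply/seteqP; split=> _ [h hg <-]; exists h; rewrite ?sE.
Qed.

Section SpectralMeasure.
Context {R : realType}.
Variables (L : hilbertType R) (E : set R -> 'B(L)).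
Hypothesis hE : is_spectral_measure E.
Implicit Types (D : set R) (x y : L).

Lemma specK D x : measurable D -> E D (E D x) = E D x.
Proof. by case: hE => pE _ _ /pE[EE _]; exact: (bop_eqE EE x). Qed.

Lemma spec_sym D x y : measurable D -> rdot (E D x) y = rdot x (E D y).
Proof. by case: hE => pE _ _ /pE[_ Es]; rewrite adjoint_rdot Es. Qed.

Lemma spec_nrm D x : measurable D -> nrm (E D x) ^+ 2 = rdot (E D x) x.
Proof. by move=> mD; rewrite nrm_sqr -[LHS]spec_sym// specK. Qed.

Lemma spec_contr D x : measurable D -> nrm (E D x) <= nrm x.
Proof.
move=> mD; have [->|n0] := eqVneq (nrm (E D x)) 0; first exact: nrm_ge0.
by rewrite -(@ler_pM2l _ (nrm (E D x))) ?lt_def ?n0 ?nrm_ge0// -expr2 spec_nrm// rdot_le.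
Qed.

Lemma spec_series (F : (set R)^nat) x : (forall n, measurable (F n)) ->
  trivIset setT F -> ncvg (series (fun n => E (F n) x)) (E (\bigcup_n F n) x).
Proof. by move=> mF tF; apply: cvg_ncvg; case: hE => _ _; exact. Qed.

Lemma spec0 x : E set0 x = 0.
Proof.
have tF : trivIset setT (fun _ : nat => set0 : set R) by apply: trivIset_set0.
have := @spec_series (fun=> set0) x (fun=> measurable0) tF; rewrite bigcup0// => h.
have := ncvgD (ncvg_shift h) (ncvgZ (-1) h); rewrite scaleN1r subrr => h0.
apply: (ncvg_uniq (ncvg_cst _)); move: h0; congr ncvg; apply/funext => n.
by rewrite scaleN1r /series/= big_nat_recr//= addrAC subrr add0r.
Qed.

Lemma specU D D' x : measurable D -> measurable D' -> D `&` D' = set0 ->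
  E (D `|` D') x = E D x + E D' x.
Proof.
move=> mD mD' DD'.
have := @spec_series (bigcup2 D D') x; rewrite bigcup2E => h.
have {}h := ncvg_shift (ncvg_shift (h _ _)).
apply: (ncvg_uniq (h _ _)).
- by move=> [|[|n]] /=.
- by rewrite -trivIset_bigcup2.
apply: (_ : ncvg (fun=> E D x + E D' x) _ -> _) (ncvg_cst _).
congr ncvg; apply/funext => n; rewrite /series/= !big_nat_recl//=.
by rewrite big1 ?addr0// => i _; rewrite spec0.
Qed.

(** Apply the contraction [E (D `|` D')] to a vector [y] of the range of [E D']:
    [|y|^2 >= |E D y|^2 + |y|^2]. *)
Lemma spec_orth D D' x : measurable D -> measurable D' -> D `&` D' = set0 ->
  E D (E D' x) = 0.
Proof.
move=> mD mD' DD'; set y := E D' x.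
have Ey : E D' y = y by rewrite /y specK.
have := @spec_contr (D `|` D') y (measurableU _ _ mD mD').
rewrite -(@ler_pXn2r _ 2) ?nnegrE ?nrm_ge0// spec_nrm; last exact: measurableU.
rewrite specU// rdotDl Ey -spec_nrm// -nrm_sqr gerDr => h.
by apply/nrm_eq0/eqP; rewrite -sqrf_eq0; apply/eqP/le_anti; rewrite h sqr_ge0.
Qed.

Lemma spec_mul D D' x : measurable D -> measurable D' ->
  E D (E D' x) = E (D `&` D') x.
Proof.
move=> mD mD'; have mI : measurable (D `&` D') by exact: measurableI.
have dec A B : measurable A -> measurable B ->
    forall z, E A z = E (A `&` B) z + E (A `\` B) z.
  move=> mA mB z; rewrite -specU//; [by rewrite setUIDK|exact: measurableI|exact: measurableD|].
  by apply/seteqP; split=> // r [[_ Br] [_]].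
have h1 : E D (E (D' `\` D) x) = 0.
  apply: spec_orth; [by []|exact: measurableD|].
  by apply/seteqP; split=> // r [Dr [_]].
have h2 z : E (D `\` D') (E (D `&` D') z) = 0.
  apply: spec_orth; [exact: measurableD|by []|].
  by apply/seteqP; split=> // r [[_ nr] []].
rewrite (dec D' D)// bopD h1 addr0 [D' `&` D]setIC (dec D D')// h2 addr0.
by rewrite specK.
Qed.

Let I01 : set R := [set` `[(0 : R), 1]].

Lemma spec_supp D x : measurable D -> E D x = E (D `&` I01) x.
Proof.
move=> mD; rewrite -spec_mul//; last exact: measurable_itv.
by case: hE => _ EI _; rewrite EI.
Qed.

Lemma specT x : E setT x = x.
Proof. by rewrite spec_supp ?setTI; [case: hE => _ -> _|exact: measurableT]. Qed.

Lemma specC D x : measurable D -> E (~` D) x = x - E D x.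
Proof.
move=> mD; rewrite -[X in X - _](specT x) -(setUv D) specU ?setICr//.
  by rewrite addrC addKr.
exact: measurableC.
Qed.

End SpectralMeasure.

(** The scalar measure [<E(D) x, x>], written as a square so that it is
    nonnegative on all sets, measurable or not. *)
Definition spec_meas (R : realType) (L : hilbertType R) (E : set R -> 'B(L))
  (hE : is_spectral_measure E) (x : L) (D : set R) : \bar R := (nrm (E D x) ^+ 2)%:E.

Section SpectralScalar.
Context {R : realType}.
Variables (L : hilbertType R) (E : set R -> 'B(L)).
Hypothesis hE : is_spectral_measure E.
Variable x : L.
Local Notation mu := (spec_meas hE x).

Lemma spec_meas0 : mu set0 = 0%E.
Proof. by rewrite /spec_meas spec0// nrm0 expr0n. Qed.

Lemma spec_meas_ge0 D : (0 <= mu D)%E.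
Proof. by rewrite lee_fin sqr_ge0. Qed.

Lemma spec_meas_sigma : semi_sigma_additive mu.
Proof.
move=> F mF tF mU.
rewrite (_ : (fun n => _) = (EFin \o fun n => rdot (series (fun n => E (F n) x) n) x)); last first.
  apply/funext => n; rewrite /= /series/=.
  elim: n => [|n IH]; first by rewrite !big_geq// rdot0l.
  rewrite !big_nat_recr//= IH rdotDl EFinD; congr (_ + _)%E.
  by rewrite /spec_meas spec_nrm.
rewrite /spec_meas spec_nrm//; apply: cvg_EFin; first exact: nearW.
apply/cvgrPdist_lt => e e0.
have x1 : 0 < nrm x + 1 by have := nrm_ge0 x; lra.
have [N hN] := spec_series hE x mF tF (divr_gt0 e0 x1).
exists N => // n /hN; rewrite ltr_pdivlMr// => h /=.
rewrite -rdotBl ltr_norml.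
set u := series _ _ in h *; set v := E _ _ in h *.
have uv : rdot (u - v) x = - rdot (v - u) x by rewrite -rdotNl opprB.
have := rdot_le (u - v) x; have := rdot_le (v - u) x; rewrite uv (nrmB v).
have := nrm_ge0 x; have := nrm_ge0 (u - v).
by move: h; move: (nrm _) (nrm _) (rdot _ _) => *; apply/andP; split; nra.
Qed.

HB.instance Definition _ := isMeasure.Build _ _ R mu
  spec_meas0 spec_meas_ge0 spec_meas_sigma.

End SpectralScalar.

(** * The operator of a projection-valued measure *)

Section SpectralOperator.
Context {R : realType}.
Variables (L : hilbertType R) (E : set R -> 'B(L)) (A : 'B(L)).
Hypothesis hE : is_spectral_measure E.
Hypothesis pA : posop A.
Hypothesis hA : forall x,
  (\int[fun D => (complex.Re (inner (E D x) x))%:E]_(t in `[0%R, 1%R]) t%:E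
       = (complex.Re (inner (A x) x))%:E)%E.
Implicit Types (D : set R) (x y : L).

Lemma spec_integral x :
  (\int[spec_meas hE x]_(t in `[0%R, 1%R]) t%:E = (rdot (A x) x)%:E)%E.
Proof.
rewrite -hA; apply: eq_integral_measurable => X mX.
by rewrite /spec_meas spec_nrm.
Qed.

(** For [u] and [v] in the ranges of [E D] and [E D'], the measure of [u + v] is
    the sum of those of [u] and [v]; integrating, the cross term of the form of
    [A] vanishes. *)
Lemma spec_form_orth D D' x y : measurable D -> measurable D' -> D `&` D' = set0 ->
  rdot (A (E D x)) (E D' y) = 0.
Proof.
move=> mD mD' DD'; set u := E D x; set v := E D' y.
have meas F : measurable F ->
    spec_meas hE (u + v) F = measure_add (spec_meas hE u) (spec_meas hE v) F.
  move=> mF; rewrite measure_addE /spec_meas -EFinD; congr EFin.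
  have cross : rdot (E F u) (E F v) = 0.
    rewrite /u /v !(spec_mul hE)// (spec_sym hE); last exact: measurableI.
    rewrite (spec_mul hE); [|exact: measurableI|exact: measurableI].
    by rewrite setIACA DD' setI0 (spec0 hE) rdot0r.
  by rewrite bopD !nrm_sqr rdotDl !rdotDr cross (rdotC (E F v)) cross addr0 add0r.
have := spec_integral (u + v).
rewrite (eq_integral_measurable _ _ meas) ge0_integral_measure_add//.
2: by move=> t; rewrite /= in_itv/= lee_fin => /andP[].
rewrite !spec_integral -EFinD => -[].
rewrite bopD rdotDl !rdotDr (posop_sym v u pA) (rdotC v).
by move: (rdot (A u) u) (rdot _ _) (rdot _ _) => *; lra.
Qed.

(** The range of [E D] is invariant under [A], its orthogonal complement being
    the range of [E (~` D)]. *)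
Lemma spec_comm D x : measurable D -> A (E D x) = E D (A (E D x)).
Proof.
move=> mD; apply: rdot_ext => y.
have mDC : measurable (~` D) by exact: measurableC.
have := spec_form_orth x y mD mDC (setICr D).
rewrite (specC hE)// rdotBr -[rdot _ (E D y)](spec_sym hE)// => /eqP.
by rewrite subr_eq0 => /eqP.
Qed.

Lemma spec_commC D x : measurable D -> E D (A x) = A (E D x).
Proof.
move=> mD; apply: rdot_ext => y.
rewrite (spec_sym hE)// posop_sym// (spec_comm y mD) -(spec_sym hE)//.
by rewrite [in RHS](spec_comm x mD) [RHS](spec_sym hE)// [RHS]posop_sym.
Qed.

Lemma spec_meas_I01 x : spec_meas hE x `[0, 1]%classic = (nrm x ^+ 2)%:E.
Proof. by rewrite /spec_meas; case: hE => _ -> _. Qed.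

Lemma spec_meas_compl D u : measurable D -> E D u = u ->
  {ae spec_meas hE u, forall t, D t}.
Proof.
move=> mD Du; exists (~` D); split; [exact: measurableC| |by []].
by rewrite /spec_meas (specC hE)// Du subrr nrm0 expr0n.
Qed.

Lemma spec_upper D u a : measurable D -> E D u = u -> 0 <= a ->
  (forall t, D t -> t <= a) -> rdot (A u) u <= a * nrm u ^+ 2.
Proof.
move=> mD Du a0 Da; rewrite -lee_fin -spec_integral EFinM -spec_meas_I01.
rewrite -integral_cst//; apply: ae_ge0_le_integral => //.
- by move=> t; rewrite /= in_itv/= lee_fin => /andP[].
- by apply: filterS (spec_meas_compl mD Du) => t /Da ta _; rewrite lee_fin.
Qed.

Lemma spec_lower D u b : measurable D -> E D u = u -> 0 <= b ->
  (forall t, D t -> b <= t) -> b * nrm u ^+ 2 <= rdot (A u) u.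
Proof.
move=> mD Du b0 Db; rewrite -lee_fin -spec_integral EFinM -spec_meas_I01.
rewrite -integral_cst//; apply: ae_ge0_le_integral => //.
- by move=> t; rewrite /= in_itv/= lee_fin => /andP[].
- by apply: filterS (spec_meas_compl mD Du) => t /Db bt _; rewrite lee_fin.
Qed.

Lemma spec_iter D u n : measurable D -> E D u = u -> E D (iter n A u) = iter n A u.
Proof. by move=> mD Du; elim: n => //= n IH; rewrite spec_commC// IH. Qed.

Lemma spec_iter_upper D u a n : measurable D -> E D u = u -> 0 <= a ->
  (forall t, D t -> t <= a) -> nrm (iter n A u) <= a ^+ n * nrm u.
Proof.
move=> mD Du a0 Da.
elim: n => [|n IH]; first by rewrite expr0 mul1r.
rewrite exprS -mulrA (le_trans _ (ler_wpM2l a0 IH))//=.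
have := spec_iter n mD Du; set v := iter n A u => Dv.
rewrite -(@ler_pXn2r _ 2) ?nnegrE ?mulr_ge0 ?nrm_ge0//.
have ADv : E D (A v) = A v by rewrite spec_commC// Dv.
rewrite (le_trans (posop_nrm pA (spec_upper mD ADv a0 Da)))//.
by rewrite exprMn expr2 -mulrA ler_wpM2l// (spec_upper mD Dv).
Qed.

Lemma spec_iter_lower D u b n : measurable D -> E D u = u -> 0 <= b ->
  (forall t, D t -> b <= t) -> b ^+ n * nrm u <= nrm (iter n A u).
Proof.
move=> mD Du b0 Db.
elim: n => [|n IH]; first by rewrite expr0 mul1r.
rewrite exprS -mulrA (le_trans (ler_wpM2l b0 IH))//=.
have := spec_iter n mD Du; set v := iter n A u => Dv.
have [->|v0] := eqVneq (nrm v) 0; first by rewrite mulr0 nrm_ge0.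
rewrite -(@ler_pM2r _ (nrm v)) ?lt_def ?v0 ?nrm_ge0// -mulrA -expr2.
by rewrite (le_trans (spec_lower mD Dv b0 Db))// rdot_le.
Qed.

End SpectralOperator.

(** * Uniqueness of the spectral measure *)

Lemma sym_quad_ext (R : realType) (L : hilbertType R) (X Y : 'B(L)) :
  (forall x y, rdot (X x) y = rdot x (X y)) ->
  (forall x y, rdot (Y x) y = rdot x (Y y)) ->
  (forall x, rdot (X x) x = rdot (Y x) x) -> X = Y.
Proof.
move=> sX sY XY; apply: bop_ext => x; apply: rdot_ext => y.
have := XY (x + y); rewrite !bopD !rdotDl !rdotDr !XY (sX y x) (sY y x).
rewrite (rdotC y (X x)) (rdotC y (Y x)).
by move: (rdot (X x) y) (rdot (Y x) y) (rdot (Y x) x) (rdot (Y y) y) => *; lra.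
Qed.

Section SpectralUniqueness.
Context {R : realType}.
Variables (L : hilbertType R) (A : 'B(L)).
Hypothesis pA : posop A.
Implicit Types (E F : set R -> 'B(L)).

(** The property by which [spectral_measure] selects its value. *)
Definition represents E : Prop := is_spectral_measure E /\ forall x,
  (\int[fun D => (complex.Re (inner (E D x) x))%:E]_(t in `[0%R, 1%R]) t%:E
       = (complex.Re (inner (A x) x))%:E)%E.

(** Compare growth rates: with [u = E D x] and [z = F D' u], the vector
    [A^n z = F D' (A^n u)] has norm at least [b^n |z|] and at most [a^n |u|].
    As [a < b], this forces [z = 0]. *)
Lemma represents_cross E F (D D' : set R) (a b : R) x : represents E -> represents F ->
  measurable D -> measurable D' -> 0 <= a -> a < b ->
  (forall t, D t -> t <= a) -> (forall t, D' t -> b <= t) ->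
  F D' (E D x) = 0.
Proof.
move=> [hE EA] [hF FA] mD mD' a0 ab Da D'b; have b0 := le_lt_trans a0 ab.
set u := E D x; set z := F D' u.
have Du : E D u = u by rewrite (specK hE).
have Dz : F D' z = z by rewrite (specK hF).
have zu n : nrm z <= (a / b) ^+ n * nrm u.
  rewrite expr_div_n mulrAC ler_pdivlMr ?exprn_gt0// mulrC.
  rewrite (le_trans (spec_iter_lower hF pA FA n mD' Dz (ltW b0) D'b))//.
  rewrite (le_trans _ (spec_iter_upper hE pA EA n mD Du a0 Da))//.
  rewrite (_ : iter n A z = F D' (iter n A u)); first exact: spec_contr.
  by elim: n => //= n ->; rewrite (spec_commC hF).
apply: nrm_eps0 => e e0.
have q1 : `|a / b| < 1.
  by rewrite ger0_norm ?divr_ge0// ?(ltW b0)// ltr_pdivrMr// mul1r.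
have u1 : 0 < nrm u + 1 by have := nrm_ge0 u; lra.
have /cvgrPdist_lt/(_ _ (divr_gt0 e0 u1))[N _ /(_ N (leqnn _))] := cvg_expr q1.
rewrite /= sub0r normrN ger0_norm ?exprn_ge0 ?divr_ge0// ?(ltW b0)//.
rewrite ltr_pdivlMr// => h; rewrite (le_trans (zu N))// (le_trans _ (ltW h))//.
rewrite ler_wpM2l ?exprn_ge0 ?divr_ge0// ?(ltW b0)//; lra.
Qed.

Let below (a : R) : set R := `]-oo, a[%classic.

Let mbelow a : measurable (below a). Proof. exact: measurable_itv. Qed.

(** [represents_cross] needs a gap between the two sets: exhaust [below a] by
    the sets [below a'] with [a' < a]. *)
Lemma represents_below_compl E F a x : represents E -> represents F ->
  E (below a) (F (~` below a) x) = 0.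
Proof.
move=> rE rF; have [hE EA] := rE; have [hF FA] := rF.
have mC : measurable (~` below a) by exact: measurableC.
set y := F _ x.
(* Half-lines below 0 miss the unit interval, which carries [E]. *)
have step a' : a' < a -> E (below a') y = 0.
  move=> a'a; have [a'0|/ltW a'0] := leP a' 0.
    rewrite (spec_supp hE)// (_ : _ `&` _ = set0) ?(spec0 hE)//.
    apply/seteqP; split=> // t []; rewrite /below/= !in_itv/= => ta' /andP[t0 _].
    by have := lt_le_trans (le_lt_trans t0 ta') a'0; rewrite ltxx.
  apply: rdot_ext => z; rewrite rdot0l (spec_sym hE)// (spec_sym hF)//.
  rewrite (represents_cross z rE rF (mbelow a') mC a'0 a'a) ?rdot0r//.
    by move=> t; rewrite /below/= in_itv/= => /ltW.
  by move=> t; rewrite /below/= in_itv/= => /negP; rewrite -leNgt.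
have : (spec_meas hE y).-negligible (below a).
  rewrite (_ : below a = \bigcup_n below (a - n.+1%:R^-1)).
    apply: negligible_bigcup => n; apply/negligibleP => //.
    change (spec_meas hE y (below (a - n.+1%:R^-1)) = 0%E).
    by rewrite /spec_meas step ?nrm0 ?expr0n// gtrBl invr_gt0.
  apply/seteqP; split=> t; rewrite /below/= in_itv/=.
    rewrite -subr_gt0 => ta.
    have [n _ /(_ n (leqnn _)) hn] := near_infty_natSinv_lt (PosNum ta).
    by exists n => //=; rewrite in_itv/= ltrBrDr -ltrBrDl.
  by move=> [n _]; rewrite /= in_itv/= => /lt_trans; apply; rewrite gtrBl invr_gt0.
move=> /(measure_negligible (mbelow a))[] /eqP; rewrite sqrf_eq0 => /eqP.
exact: nrm_eq0.
Qed.

Lemma represents_below E F a : represents E -> represents F ->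
  E (below a) = F (below a).
Proof.
move=> rE rF; have [hE EA] := rE; have [hF FA] := rF.
have EF x : E (below a) x = E (below a) (F (below a) x).
  have := represents_below_compl a x rE rF; rewrite (specC hF)// bopB.
  by move=> /eqP; rewrite subr_eq0 => /eqP.
have FE x : F (below a) x = F (below a) (E (below a) x).
  have := represents_below_compl a x rF rE; rewrite (specC hE)// bopB.
  by move=> /eqP; rewrite subr_eq0 => /eqP.
apply: bop_ext => x; apply: rdot_ext => y.
by rewrite EF (spec_sym hE)// (spec_sym hF)// -FE -(spec_sym hF).
Qed.

(** The two families agree on the open half-lines by [represents_below], hence
    so do the finite scalar measures attached to each vector, on all Borel
    sets. *)
Lemma represents_uniq E F D : represents E -> represents F -> measurable D ->
  E D = F D.
Proof.
move=> rE rF mD; have [hE EA] := rE; have [hF FA] := rF.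
apply: sym_quad_ext => [x y|x y|x]; [exact: spec_sym|exact: spec_sym|].
rewrite -!spec_nrm//.
suff : spec_meas hE x D = spec_meas hF x D by case.
apply: (measure_unique (@RGenInftyO.G R) (fun n => below n%:R)) => //.
- exact: RGenInftyO.measurableE.
- move=> _ _ [a ->] [b ->]; exists (Num.min a b); apply/seteqP; split=> t /=.
    by rewrite !in_itv/= lt_min => -[-> ->].
  by rewrite !in_itv/= lt_min => /andP[].
- by move=> n; exists n%:R.
- apply/seteqP; split=> // t _; exists (Num.bound `|t|) => //=.
  by rewrite /below/= in_itv/= (le_lt_trans (ler_norm t))// archi_boundP.
- move=> _ [a ->]; change (spec_meas hE x (below a) = spec_meas hF x (below a)).
  by rewrite /spec_meas (represents_below a rE rF).
- by move=> n; change (spec_meas hE x (below n%:R) < +oo)%E; rewrite ltry.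
Qed.

End SpectralUniqueness.

(** * Unitary invariance of the calculus *)

Section Transport.
Context {R : realType}.

Lemma represents_transport (L1 L2 : hilbertType R) (U : 'B(L1, L2))
    (A1 : 'B(L1)) (A2 : 'B(L2)) E :
  U^*o *o U = 1%:B -> U *o U^*o = 1%:B -> A1 = U^*o *o A2 *o U ->
  represents A2 E -> represents A1 (fun D => U^*o *o E D *o U).
Proof.
move=> UU UU' A12 [hE EA]; have [pE EI sE] := hE.
have UUE x : U^*o (U x) = x := bop_eqE UU x.
have UUE' x : U (U^*o x) = x := bop_eqE UU' x.
split; [split|].
- move=> D mD; have [EE Es] := pE _ mD; split.
    apply: bop_ext => x.
    rewrite -[LHS]/(U^*o (E D (U (U^*o (E D (U x)))))) UUE'.
    by rewrite (bop_eqE EE (U x) : E D (E D _) = _).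
  by rewrite !adjoint_comp adjointK Es bop_compA.
- by rewrite EI; apply: bop_ext => x; exact: UUE.
- move=> F mF tF x; apply: ncvg_cvg.
  have := ncvg_bop U^*o (spec_series hE (U x) mF tF).
  congr ncvg; apply/funext => n; rewrite /series/=.
  by apply: (big_morph _ (bopD _) (bop0 _)).
move=> x; have := EA (U x).
rewrite (_ : complex.Re (inner (A1 x) x) = complex.Re (inner (A2 (U x)) (U x))).
  move=> <-; congr integral; apply/funext => D; congr EFin.
  exact: adjoint_rdotr.
rewrite A12; exact: adjoint_rdotr.
Qed.

Lemma spectral_measureE (L : hilbertType R) (A : 'B(L)) :
  spectral_measure A = xget (fun=> 0) [set E | represents A E].
Proof. by []. Qed.

(** Unitary conjugation is a bijection between the families representing [A2]
    and those representing [A1].  So both are chosen, and agree by uniqueness, or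
    there is none on either side and both take the default value. *)
Lemma spectral_measure_transport (L1 L2 : hilbertType R) (U : 'B(L1, L2))
    (A1 : 'B(L1)) (A2 : 'B(L2)) D : posop A1 ->
  U^*o *o U = 1%:B -> U *o U^*o = 1%:B -> A1 = U^*o *o A2 *o U -> measurable D ->
  spectral_measure A1 D = U^*o *o spectral_measure A2 D *o U.
Proof.
move=> pA1 UU UU' A12 mD; rewrite !spectral_measureE.
have UUE x : U^*o (U x) = x := bop_eqE UU x.
have UUE' x : U (U^*o x) = x := bop_eqE UU' x.
have [[E2 rE2]|nE2] := pselect (exists E, represents A2 E).
  have r2 := xgetPex (fun=> 0) (ex_intro [set E | represents A2 E] _ rE2).
  have r21 := represents_transport UU UU' A12 r2.
  have r1 := xgetPex (fun=> 0) (ex_intro [set E | represents A1 E] _ r21).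
  exact: (represents_uniq pA1 r1 r21 mD).
have r2 E : ~ [set E | represents A2 E] E by move=> rE; apply: nE2; exists E.
have r1 E : ~ [set E | represents A1 E] E.
  move=> rE; apply: nE2; exists (fun D => U^*o^*o *o E D *o U^*o).
  apply: represents_transport rE; rewrite ?adjointK// A12.
  by apply: bop_ext => x /=; rewrite !UUE'.
rewrite (xgetPN _ r2) (xgetPN _ r1); apply: bop_ext => x.
by rewrite -[RHS]/(U^*o 0) bop0.
Qed.

Lemma pw_calculus1_transport (f : R -> R) (L1 L2 : hilbertType R) (U : 'B(L1, L2))
    (A1 : 'B(L1)) (A2 : 'B(L2)) : posop A1 ->
  U^*o *o U = 1%:B -> U *o U^*o = 1%:B -> A1 = U^*o *o A2 *o U ->
  compress U (pw_calculus1 f A2) = pw_calculus1 f A1.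
Proof.
move=> pA1 UU UU' A12; apply/funext => omega.
apply: eq_integral_measurable => D mD; congr (complex.Re (omega _))%:E.
by rewrite (spectral_measure_transport pA1 UU UU' A12 mD).
Qed.

End Transport.

(** * Uniqueness of minimal Stinespring representations *)

Section Uniqueness.
Context {R : realType}.
Variables (H0 H : hilbertType R) (M : set 'B(H0)) (vnM : von_neumann M).

(** The graph of the intertwiner [pi1 x (W1 h) |-> pi2 x (W2 h)] on the linear
    span of the generators.  That it is single-valued follows only from
    [span_graph_form].  Scalars are absorbed into [h]. *)
Inductive span_graph (K1 K2 : hilbertType R) (pi1 : 'B(H0) -> 'B(K1)) (W1 : 'B(H, K1))
    (pi2 : 'B(H0) -> 'B(K2)) (W2 : 'B(H, K2)) : K1 -> K2 -> Prop :=
| SpanGraph0 : span_graph pi1 W1 pi2 W2 0 0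
| SpanGraphS x h u v : M x -> span_graph pi1 W1 pi2 W2 u v ->
   span_graph pi1 W1 pi2 W2 (pi1 x (W1 h) + u) (pi2 x (W2 h) + v).

Section Graph.
Variables (K1 K2 : hilbertType R) (pi1 : 'B(H0) -> 'B(K1)) (W1 : 'B(H, K1)).
Variables (pi2 : 'B(H0) -> 'B(K2)) (W2 : 'B(H, K2)).
Local Notation graph := (span_graph pi1 W1 pi2 W2).

Lemma span_graph_swap u v : graph u v -> span_graph pi2 W2 pi1 W1 v u.
Proof. by elim=> [|x h {}u {}v Mx _ IH]; [exact: SpanGraph0|exact: SpanGraphS]. Qed.

Lemma span_graphP (a : R[i]) u v u' v' : graph u v -> graph u' v' ->
  graph (a *: u + u') (a *: v + v').
Proof.
move=> g g'; elim: g => [|x h {}u {}v Mx _ IH]; first by rewrite !scaler0 !add0r.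
by rewrite !scalerDr -!addrA -!bopZ; exact: SpanGraphS.
Qed.

Lemma span_graph_gen x h : M x -> graph (pi1 x (W1 h)) (pi2 x (W2 h)).
Proof. by move=> Mx; have := SpanGraphS h Mx (SpanGraph0 pi1 W1 pi2 W2); rewrite !addr0. Qed.

Lemma span_graph_dense :
  closure (linear_span [set pi1 x (W1 h) | x in M & h in [set: H]]) = setT ->
  dense_in (fun u => exists v, graph u v).
Proof.
move=> /dense_closure dW u e /(dW u)[_ [n [a [s [hs ->]]]] ue].
exists (\sum_i a i *: s i) => //; elim/big_ind : _.
- by exists 0; exact: SpanGraph0.
- move=> u1 u2 [v1 g1] [v2 g2]; exists (v1 + v2).
  by have := span_graphP 1 g1 g2; rewrite !scale1r.
- move=> i _; have [x Mx [h _ <-]] := hs i; exists (a i *: pi2 x (W2 h)).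
  have := span_graphP (a i) (span_graph_gen h Mx) (SpanGraph0 pi1 W1 pi2 W2).
  by rewrite !addr0.
Qed.

(** Move [pi y] to the left factor and through [A]: the form of [A] on the
    generators depends on [Theta] alone. *)
Lemma RN_derivative_form K (pi : 'B(H0) -> 'B(K)) (W : 'B(H, K)) Theta A x y h k :
  unital_star_rep M pi -> RN_derivative M Theta pi W A -> M x -> M y ->
  rdot (A (pi x (W h))) (pi y (W k)) = rdot (Theta (y^*o *o x) h) k.
Proof.
have [_ _ MM Ms _] := vnM.
move=> [_ _ piM pis] [cA _ hA] Mx My.
rewrite hA ?piM//; [|exact: Ms|by apply: MM => //; exact: Ms].
rewrite -[in RHS]/(W^*o (A (pi y^*o (pi x (W h))))) adjoint_rdotr.
have piy : (pi @` M) (pi y^*o) by exists y^*o => //; exact: Ms.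
rewrite -(bop_eqE (cA _ piy) (pi x (W h)) : pi y^*o (A _) = A (pi y^*o _)).
by rewrite pis// adjoint_rdotr.
Qed.

(** With [A1] and [A2] the identities, this is the isometry of the intertwiner;
    with the derivatives of another map, it says that the intertwiner carries
    one derivative to the other. *)
Lemma span_graph_form Theta A1 A2 u v u' v' :
  unital_star_rep M pi1 -> unital_star_rep M pi2 ->
  RN_derivative M Theta pi1 W1 A1 -> RN_derivative M Theta pi2 W2 A2 ->
  graph u v -> graph u' v' -> rdot (A1 u) u' = rdot (A2 v) v'.
Proof.
move=> r1 r2 RN1 RN2; elim=> [_|x h {}u {}v Mx _ IH g']; first by rewrite !bop0 !rdot0l.
rewrite !bopD !rdotDl (IH g') => {IH}; congr (_ + _).
elim: g' => [|y k {}u' {}v' My _ IH']; first by rewrite !rdot0r.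
by rewrite !rdotDr IH' (RN_derivative_form _ _ r1 RN1)// (RN_derivative_form _ _ r2 RN2).
Qed.

Lemma stinespring_derivative K (pi : 'B(H0) -> 'B(K)) (W : 'B(H, K)) Theta :
  minimal_stinespring M Theta pi W -> RN_derivative M Theta pi W 1%:B.
Proof.
move=> [_ hT _]; split.
- by move=> _ [x Mx <-]; exact: bop_ext.
- by apply: posop_intro => // x; rewrite -nrm_sqr sqr_ge0.
- by move=> x Mx; rewrite hT//; exact: bop_ext.
Qed.

End Graph.

Section Unitary.
Variables (K1 K2 : hilbertType R) (pi1 : 'B(H0) -> 'B(K1)) (W1 : 'B(H, K1)).
Variables (pi2 : 'B(H0) -> 'B(K2)) (W2 : 'B(H, K2)).
Local Notation graph := (span_graph pi1 W1 pi2 W2).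

Lemma stinespring_unitary Theta Phi A1 A2 :
  minimal_stinespring M Theta pi1 W1 -> minimal_stinespring M Theta pi2 W2 ->
  RN_derivative M Phi pi1 W1 A1 -> RN_derivative M Phi pi2 W2 A2 ->
  exists U : 'B(K1, K2), [/\ U^*o *o U = 1%:B, U *o U^*o = 1%:B,
    U *o W1 = W2 & A1 = U^*o *o A2 *o U].
Proof.
move=> m1 m2 RN1 RN2; have [r1 _ d1] := m1; have [r2 _ d2] := m2.
have iso u v u' v' : graph u v -> graph u' v' -> rdot u u' = rdot v v'.
  exact: (span_graph_form r1 r2 (stinespring_derivative m1) (stinespring_derivative m2)).
have dense1 := span_graph_dense pi2 W2 d1.
have dense2 : dense_in (fun v => exists u, graph u v).
  move=> v e /(span_graph_dense pi1 W1 d2 v)[v' [u g] vv']; exists v' => //.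
  by exists u; exact: span_graph_swap.
have [U hU] : exists U : 'B(K1, K2), forall u v, graph u v -> U u = v.
  apply: (extend_graph ler01 _ _ dense1).
    by move=> a u v u' v'; exact: span_graphP.
  move=> u v g; rewrite mul1r -(@ler_pXn2r _ 2) ?nnegrE ?nrm_ge0// !nrm_sqr.
  by rewrite (iso _ _ _ _ g g).
have UU : U^*o *o U = 1%:B.
  apply: (dense_bop dense1) => u [v g]; apply: (dense_rdot dense1) => u' [v' g'].
  by rewrite -[LHS]/(rdot (U^*o (U u)) u') adjoint_rdotr (hU _ _ g) (hU _ _ g') -(iso _ _ _ _ g g').
exists U; split=> //.
- apply: (dense_bop dense2) => v [u g].
  by rewrite -(hU _ _ g) -[LHS]/(U (U^*o (U u))) (bop_eqE UU u : U^*o (U u) = u).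
- apply: bop_ext => h; have [M1 _ _ _ _] := vnM.
  have [pi11 _ _ _] := r1; have [pi21 _ _ _] := r2.
  by have := span_graph_gen pi1 W1 pi2 W2 h M1; rewrite pi11 pi21 => /hU.
- apply: (dense_bop dense1) => u [v g]; apply: (dense_rdot dense1) => u' [v' g'].
  rewrite -[RHS]/(rdot (U^*o (A2 (U u))) u') adjoint_rdotr (hU _ _ g) (hU _ _ g').
  exact: (span_graph_form r1 r2 RN1 RN2).
Qed.

End Unitary.

Lemma compress_pw_calculus1_unique (f : R -> R) (K1 K2 : hilbertType R)
    (pi1 : 'B(H0) -> 'B(K1)) (W1 : 'B(H, K1)) (pi2 : 'B(H0) -> 'B(K2)) (W2 : 'B(H, K2))
    Theta Phi A1 A2 :
  minimal_stinespring M Theta pi1 W1 -> minimal_stinespring M Theta pi2 W2 ->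
  RN_derivative M Phi pi1 W1 A1 -> RN_derivative M Phi pi2 W2 A2 ->
  compress W1 (pw_calculus1 f A1) = compress W2 (pw_calculus1 f A2).
Proof.
move=> m1 m2 RN1 RN2; have [U [UU UU' <- A12]] := stinespring_unitary m1 m2 RN1 RN2.
have [_ pA1 _] := RN1.
by rewrite -compress_comp (pw_calculus1_transport f pA1 UU UU' A12).
Qed.

(** Every representation in which [Phi] and [Psi] have derivatives [A] and [B]
    yields a minimal realization of the pair with the same calculus: cut down to
    the closed range of [A + B] along [T]. *)
Lemma realization_to_SRN (f : R -> R) (K : hilbertType R) (Gamma Phi Psi : 'B(H0) -> 'B(H))
    (pi : 'B(H0) -> 'B(K)) (V : 'B(H, K)) (A B : 'B(K)) :
  minimal_stinespring M Gamma pi V ->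
  RN_derivative M Phi pi V A -> RN_derivative M Psi pi V B ->
  exists (L : hilbertType R) (piL : 'B(H0) -> 'B(L)) (W : 'B(H, L)) (X Y : 'B(L)),
    minimal_SRN M Phi Psi piL W X Y /\
    compress V (pw_calculus f A B) = compress W (pw_calculus1 f X).
Proof.
move=> mV RNA RNB; have [_ pA _] := RNA; have [_ pB _] := RNB.
have [pX pY AX BY XY] := pwRSP pA pB.
exists _, (pi_quotient pi A B), (pwT A B *o V), (pwRS A B).1, (pwRS A B).2.
split; last by rewrite pw_calculusE compress_comp.
split.
- exact: (quotient_stinespring vnM mV RNA RNB).
- exact: (quotient_derivative vnM mV RNA RNB RNA pX AX).
- exact: (posop_contraction pX pY XY).
- exact: (quotient_derivative vnM mV RNA RNB RNB pY BY).
- by apply: (posop_contraction pY pX); apply: etrans XY; exact: addrC.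
Qed.

End Uniqueness.

(** * The divergence from a dominating map *)

Theorem proposition3p4 (R : realType) (H0 H : hilbertType R)
    (M : set 'B(H0)) (N : set 'B(H))
    (vnM : von_neumann M) (vnN : von_neumann N)
    (f : R -> R) (opcf : operator_convex f)
    (Phi Psi : 'B(H0) -> 'B(H)) (cpPhi : CP M N Phi) (cpPsi : CP M N Psi) :
  (forall (Gamma : 'B(H0) -> 'B(H)) (K : hilbertType R)
     (pi : 'B(H0) -> 'B(K)) (V : 'B(H, K)) (A B : 'B(K)),
     dominated_realization M N Phi Psi Gamma pi V A B ->
     forall omega, predual_pos omega ->
       max_fdiv M f Phi Psi omega = compress V (pw_calculus f A B) omega) /\
  (forall (Gamma1 Gamma2 : 'B(H0) -> 'B(H)) (K1 K2 : hilbertType R)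
     (pi1 : 'B(H0) -> 'B(K1)) (V1 : 'B(H, K1)) (A1 B1 : 'B(K1))
     (pi2 : 'B(H0) -> 'B(K2)) (V2 : 'B(H, K2)) (A2 B2 : 'B(K2)),
     dominated_realization M N Phi Psi Gamma1 pi1 V1 A1 B1 ->
     dominated_realization M N Phi Psi Gamma2 pi2 V2 A2 B2 ->
     forall omega, predual_pos omega ->
       compress V1 (pw_calculus f A1 B1) omega
       = compress V2 (pw_calculus f A2 B2) omega).
Proof.
have main (Gamma : 'B(H0) -> 'B(H)) (K : hilbertType R)
     (pi : 'B(H0) -> 'B(K)) (V : 'B(H, K)) (A B : 'B(K)) :
     dominated_realization M N Phi Psi Gamma pi V A B ->
     max_fdiv M f Phi Psi = compress V (pw_calculus f A B).
  move=> [_ _ _ mV [RNA RNB]].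
  have [L [piL [W [X [Y [srn ->]]]]]] := realization_to_SRN vnM f mV RNA RNB.
  pose S := [set m | exists (K : hilbertType R)
    (pi : 'B(H0) -> 'B(K)) (V : 'B(H, K)) (A B : 'B(K)),
    minimal_SRN M Phi Psi pi V A B /\ m = compress V (pw_calculus f A B)].
  (* The realization just built shows that the choice in the divergence is not vacuous. *)
  have : S (max_fdiv M f Phi Psi).
    by apply: xgetPex; exists (compress W (pw_calculus f X Y)), L, piL, W, X, Y.
  move=> [K' [pi' [V' [A' [B' [[mV' RNA' _ RNB' _] ->]]]]]].
  have [L' [piL' [W' [X' [Y' [srn' ->]]]]]] := realization_to_SRN vnM f mV' RNA' RNB'.
  have [mW RNX _ _ _] := srn; have [mW' RNX' _ _ _] := srn'.
  exact: (compress_pw_calculus1_unique vnM f mW' mW RNX' RNX).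
split=> [Gamma K pi V A B dom omega _|]; first by rewrite (main _ _ _ _ _ _ dom).
move=> Gamma1 Gamma2 K1 K2 pi1 V1 A1 B1 pi2 V2 A2 B2 dom1 dom2 omega _.
by rewrite -(main _ _ _ _ _ _ dom1) (main _ _ _ _ _ _ dom2).
Qed.
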